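(* Let $A$ be a unital algebra with differential graded algebra $(\Omega,\mathrm d)$ and let $(\nabla,\sigma)$ be a bimodule connection on $\Omega^1$ which is torsion free, flat, $\wedge$-compatible, extendable and Leibniz compatible. Let $\mathcal J^3_A=A\oplus\Omega^1\oplus\Omega^2_S\oplus\Omega^3_S$ and $j^3:A\to\mathcal J^3_A$, $j^3(s)=s+\mathrm ds+\nabla\mathrm ds+\nabla_2\nabla\mathrm ds$. Then the left and right actions of $a\in A$ defined by \begin{align*} a\bullet_3s&=a\bullet_2s+(\nabla_2\nabla\mathrm da)s, & s\bullet_3a&=s\bullet_2a+s(\nabla_2\nabla\mathrm da),\\ a\bullet_3\omega&=a\bullet_2\omega+[3,\sigma](\nabla\mathrm da\otimes\omega), & \omega\bullet_3a&=\omega\bullet_2a+[3,\sigma]'(\omega\otimes\nabla\mathrm da),\\ a\bullet_3(\omega^1\otimes\omega^2)&=a\bullet_2(\omega^1\otimes\omega^2)+[3,\sigma]'(\mathrm da\otimes\omega^1\otimes\omega^2), & (\omega^1\otimes\omega^2)\bullet_3a&=(\omega^1\otimes\omega^2)\bullet_2a+[3,\sigma](\omega^1\otimes\omega^2\otimes\mathrm da),\\ a\bullet_3(\omega^1\otimes\omega^2\otimes\omega^3)&=a\omega^1\otimes\omega^2\otimes\omega^3, & (\omega^1\otimes\omega^2\otimes\omega^3)\bullet_3a&=\omega^1\otimes\omega^2\otimes\omega^3a \end{align*} for $s\in A$, $\omega\in\Omega^1$, $\omega^1\otimes\omega^2\in\Omega^2_S$ and $\omega^1\otimes\omega^2\otimes\omega^3\in\Omega^3_S$,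 make $\mathcal J^3_A$ an $A$-bimodule and $j^3$ a bimodule map. Quotienting out $\Omega^3_S$ gives a bimodule surjection $\pi_3:\mathcal J^3_A\to\mathcal J^2_A$ (with $\bullet_2$ on $\mathcal J^2_A$) such that $\pi_3\circ j^3=j^2$.
   Context: Everything is over a field. $A$ is a unital algebra and $(\Omega=\oplus_n\Omega^n,\mathrm d)$ is a differential graded algebra with $\Omega^0=A$, product $\wedge$, $\mathrm d$ of degree $1$ with $\mathrm d^2=0$ and the graded Leibniz rule, and $\Omega$ generated by $A,\mathrm dA$. Tensor products of bimodules are over $A$. Lower indices indicate position: $\wedge_i,\sigma_i$ are $\wedge,\sigma$ applied in tensor factors $i,i+1$. Elements such as $\omega^1\otimes\omega^2\in\Omega^2_S$ denote possibly sums of such terms. A bimodule connection $(\nabla,\sigma)$ on $\Omega^1$ is a linear map $\nabla:\Omega^1\to\Omega^1\otimes_A\Omega^1$ and a bimodule map $\sigma:\Omega^1\otimes_A\Omega^1\to\Omega^1\otimes_A\Omega^1$ with $\nabla(a\omega)=\mathrm da\otimes\omega+a\nabla\omega$, $\nabla(\omega a)=(\nabla\omega)a+\sigma(\omega\otimes\mathrm da)$. $\nabla_2=\nabla\otimes\mathrm{id}+\sigma_1(\mathrm{id}\otimes\nabla)$ on $\Omega^1\otimes_A\Omega^1$. The connection is: torsion free if $\wedge\nabla=\mathrm d$; flat if $(\mathrm d\otimes\mathrm{id}-\mathrm{id}\wedge\nabla)\nabla=0:\Omega^1\to\Omega^2\otimes_A\Omega^1$; $\wedge$-compatible if $\nabla_{\Omega^2}(\eta\wedge\omega):=(\nabla\eta)\wedge\omega+\wedge_2\sigma_1(\eta\otimes\nabla\omega)$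 is a well-defined bimodule connection on $\Omega^2$; extendable if $\omega\otimes\eta\wedge\zeta\mapsto\wedge_1\sigma_2\sigma_1(\omega\otimes\eta\otimes\zeta)$ is a well-defined bimodule map $\Omega^1\otimes_A\Omega^2\to\Omega^2\otimes_A\Omega^1$; Leibniz compatible if $\nabla_2\sigma_1=\sigma_2\nabla_2$ on $\Omega^1\otimes_A\Omega^1$. $\Omega^2_S=\ker\wedge\subseteq\Omega^1\otimes_A\Omega^1$; $\Omega^3_S=\ker\wedge_1\cap\ker\wedge_2\subseteq\Omega^{1\otimes_A3}$. $[2,\sigma]=\mathrm{id}+\sigma$, $[3,\sigma]=\mathrm{id}+\sigma_2+\sigma_1\sigma_2$, $[3,\sigma]'=\mathrm{id}+\sigma_1+\sigma_2\sigma_1$. $\mathcal J^2_A=A\oplus\Omega^1\oplus\Omega^2_S$, $j^2(s)=s+\mathrm ds+\nabla\mathrm ds$, with actions $a\bullet_2s=as+(\mathrm da)s+(\nabla\mathrm da)s$, $s\bullet_2a=sa+s\,\mathrm da+s\nabla\mathrm da$, $a\bullet_2\omega=a\omega+[2,\sigma](\mathrm da\otimes\omega)$, $\omega\bullet_2a=\omega a+[2,\sigma](\omega\otimes\mathrm da)$, $a\bullet_2(\omega^1\otimes\omega^2)=a\omega^1\otimes\omega^2$, $(\omega^1\otimes\omega^2)\bullet_2a=\omega^1\otimes\omega^2a$. *)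

(* Defs.v *)
From HB Require Import structures.
From mathcomp Require Import all_boot all_order all_algebra.
From mathcomp Require Import boolp.

Set Implicit Arguments.
Unset Strict Implicit.
Unset Printing Implicit Defensive.

Import GRing.Theory.
Local Open Scope ring_scope.
Local Open Scope quotient_scope.

Reserved Notation "a ▷ v" (at level 40, left associativity).
Reserved Notation "v ◁ a" (at level 40, left associativity).
Reserved Notation "x ⊗ y" (at level 40, left associativity).

(* The last two laws make the two actions of the ground field k (through A)
   agree with the k-linear structure of V. *)
Record is_bimodule (k : fieldType) (A : algType k) (V : lmodType k)
    (l : A -> V -> V) (r : V -> A -> V) : Prop := IsBimodule {
  bimod_lDl : forall a b v, l (a + b) v = l a v + l b v;
  bimod_lDr : forall a u v, l a (u + v) = l a u + l a v;
  bimod_lM : forall a b v, l (a * b) v = l a (l b v);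
  bimod_l1 : forall v, l 1 v = v;
  bimod_rDl : forall u v a, r (u + v) a = r u a + r v a;
  bimod_rDr : forall v a b, r v (a + b) = r v a + r v b;
  bimod_rM : forall v a b, r v (a * b) = r (r v a) b;
  bimod_r1 : forall v, r v 1 = v;
  bimod_lr : forall a v b, r (l a v) b = l a (r v b);
  bimod_lZ : forall (c : k) v, l c%:A v = c *: v;
  bimod_rZ : forall (c : k) v, r v c%:A = c *: v
}.

Record is_bimod_map (k : fieldType) (A : algType k) (V W : lmodType k)
    (lV : A -> V -> V) (rV : V -> A -> V) (lW : A -> W -> W) (rW : W -> A -> W)
    (f : V -> W) : Prop := IsBimodMap {
  bimod_map_linear : linear f;
  bimod_map_l : forall a v, f (lV a v) = lW a (f v);
  bimod_map_r : forall v a, f (rV v a) = rW (f v) a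
}.

HB.mixin Record Lmodule_isBimodule (k : fieldType) (A : algType k) M
    of GRing.Lmodule k M := {
  lact : A -> M -> M;
  ract : M -> A -> M;
  bimoduleP : is_bimodule lact ract
}.

#[short(type="bimodType")]
HB.structure Definition Bimodule (k : fieldType) (A : algType k) :=
  {M of GRing.Lmodule k M & Lmodule_isBimodule k A M}.

Notation "a ▷ v" := (lact a v) : ring_scope.
Notation "v ◁ a" := (ract v a) : ring_scope.

Definition bimod_hom (k : fieldType) (A : algType k) (M N : bimodType A)
  (f : M -> N) : Prop := is_bimod_map (@lact k A M) ract (@lact k A N) ract f.

Section BimoduleTheory.
Variables (k : fieldType) (A : algType k) (M : bimodType A).
Implicit Types (a b : A) (u v : M) (c : k).

Lemma lactDl a b v : (a + b) ▷ v = a ▷ v + b ▷ v.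
Proof. exact: bimod_lDl (bimoduleP (s := M)) _ _ _. Qed.
Lemma lactDr a u v : a ▷ (u + v) = a ▷ u + a ▷ v.
Proof. exact: bimod_lDr (bimoduleP (s := M)) _ _ _. Qed.
Lemma lactM a b v : (a * b) ▷ v = a ▷ (b ▷ v).
Proof. exact: bimod_lM (bimoduleP (s := M)) _ _ _. Qed.
Lemma lact1 v : (1 : A) ▷ v = v.
Proof. exact: bimod_l1 (bimoduleP (s := M)) _. Qed.
Lemma ractDl u v a : (u + v) ◁ a = u ◁ a + v ◁ a.
Proof. exact: bimod_rDl (bimoduleP (s := M)) _ _ _. Qed.
Lemma ractDr v a b : v ◁ (a + b) = v ◁ a + v ◁ b.
Proof. exact: bimod_rDr (bimoduleP (s := M)) _ _ _. Qed.
Lemma ractM v a b : v ◁ (a * b) = v ◁ a ◁ b.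
Proof. exact: bimod_rM (bimoduleP (s := M)) _ _ _. Qed.
Lemma ract1 v : v ◁ (1 : A) = v.
Proof. exact: bimod_r1 (bimoduleP (s := M)) _. Qed.
Lemma lractA a v b : a ▷ v ◁ b = a ▷ (v ◁ b).
Proof. exact: bimod_lr (bimoduleP (s := M)) _ _ _. Qed.
Lemma lactA c v : (c%:A : A) ▷ v = c *: v.
Proof. exact: bimod_lZ (bimoduleP (s := M)) _ _. Qed.
Lemma ractA c v : v ◁ (c%:A : A) = c *: v.
Proof. exact: bimod_rZ (bimoduleP (s := M)) _ _. Qed.

Lemma lact0l v : (0 : A) ▷ v = 0.
Proof. by apply: (addIr (0 ▷ v)); rewrite -lactDl !add0r. Qed.
Lemma lact0 a : a ▷ (0 : M) = 0.
Proof. by apply: (addIr (a ▷ 0)); rewrite -lactDr !add0r. Qed.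
Lemma ract0r v : v ◁ (0 : A) = 0.
Proof. by apply: (addIr (v ◁ 0)); rewrite -ractDr !add0r. Qed.
Lemma ract0 a : (0 : M) ◁ a = 0.
Proof. by apply: (addIr (0 ◁ a)); rewrite -ractDl !add0r. Qed.
Lemma lactZ a c v : a ▷ (c *: v) = c *: (a ▷ v).
Proof. by rewrite -!lactA -!lactM -scalerAr mulr1 mulr_algl. Qed.
Lemma ractZ a c v : (c *: v) ◁ a = c *: (v ◁ a).
Proof. by rewrite -!lactA lractA. Qed.

End BimoduleTheory.

(* M ⊗ N is the set of formal sums of pairs (m, n), encoded as lists, modulo
   the least congruence making (m, n) biadditive and A-balanced. *)
Section TensorDef.
Variables (k : fieldType) (A : algType k) (M N : bimodType A).

Inductive tens_eq : seq (M * N) -> seq (M * N) -> Prop :=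
| TensRefl s : tens_eq s s
| TensSym s t : tens_eq s t -> tens_eq t s
| TensTrans s t u : tens_eq s t -> tens_eq t u -> tens_eq s u
| TensCat s1 s2 t1 t2 :
    tens_eq s1 t1 -> tens_eq s2 t2 -> tens_eq (s1 ++ s2) (t1 ++ t2)
| TensCatC s t : tens_eq (s ++ t) (t ++ s)
| TensDl m m' n : tens_eq [:: (m + m', n)] [:: (m, n); (m', n)]
| TensDr m n n' : tens_eq [:: (m, n + n')] [:: (m, n); (m, n')]
| Tens0 n : tens_eq [:: (0, n)] [::]
| TensBal m a n : tens_eq [:: (m ◁ a, n)] [:: (m, a ▷ n)].

Definition tens_eqb (s t : seq (M * N)) : bool := `[< tens_eq s t >].

Lemma tens_eqb_refl : reflexive tens_eqb.
Proof. by move=> s; apply/asboolP; exact: TensRefl. Qed.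
Lemma tens_eqb_sym : symmetric tens_eqb.
Proof. by move=> s t; apply/asboolP/asboolP; exact: TensSym. Qed.
Lemma tens_eqb_trans : transitive tens_eqb.
Proof.
by move=> t s u /asboolP st /asboolP tu; apply/asboolP; exact: TensTrans tu.
Qed.

Canonical tens_equiv :=
  EquivRel tens_eqb tens_eqb_refl tens_eqb_sym tens_eqb_trans.

Definition tensor : Type := {eq_quot tens_eqb}.

HB.instance Definition _ := Choice.on tensor.
HB.instance Definition _ := EqQuotient.on tensor.

Definition tens (m : M) (n : N) : tensor := \pi_tensor [:: (m, n)].

(* The additive extension of (m, n) |-> f m n, meaningful when f is biadditive
   and A-balanced (tlift_tens below). *)
Definition tlift (V : nmodType) (f : M -> N -> V) (t : tensor) : V :=
  \sum_(p <- repr t) f p.1 p.2.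

Record balanced (V : nmodType) (f : M -> N -> V) : Prop := Balanced {
  balDl : forall m m' n, f (m + m') n = f m n + f m' n;
  balDr : forall m n n', f m (n + n') = f m n + f m n';
  bal0 : forall n, f 0 n = 0;
  balA : forall m a n, f (m ◁ a) n = f m (a ▷ n)
}.

Lemma tens_piP (s t : seq (M * N)) :
  (\pi_tensor s = \pi_tensor t) <-> tens_eq s t.
Proof.
split; first by move/eqmodP => /asboolP.
by move=> st; apply/eqmodP/asboolP.
Qed.

Lemma tens_reprP (s : seq (M * N)) : tens_eq (repr (\pi_tensor s)) s.
Proof. by apply/tens_piP; rewrite reprK. Qed.

Lemma tens_eq_sum (V : nmodType) (f : M -> N -> V) s t :
  balanced f -> tens_eq s t ->
  \sum_(p <- s) f p.1 p.2 = \sum_(p <- t) f p.1 p.2.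
Proof.
move=> bf; elim=> {s t} //=.
- by move=> s t u _ -> _ ->.
- by move=> s1 s2 t1 t2 _ e1 _ e2; rewrite !big_cat /= e1 e2.
- by move=> s t; rewrite !big_cat /= addrC.
- by move=> *; rewrite !big_cons !big_nil /= !addr0 balDl.
- by move=> *; rewrite !big_cons !big_nil /= !addr0 balDr.
- by move=> *; rewrite !big_cons !big_nil /= !addr0 bal0.
- by move=> *; rewrite !big_cons !big_nil /= !addr0 balA.
Qed.

Lemma tlift_pi (V : nmodType) (f : M -> N -> V) s :
  balanced f -> tlift f (\pi_tensor s) = \sum_(p <- s) f p.1 p.2.
Proof. by move=> bf; exact: tens_eq_sum (tens_reprP s). Qed.

Lemma tlift_tens (V : nmodType) (f : M -> N -> V) m n :
  balanced f -> tlift f (tens m n) = f m n.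
Proof. by move=> bf; rewrite tlift_pi // big_seq1. Qed.

Definition tens_map (g : M -> M) (h : N -> N) (t : tensor) : tensor :=
  \pi_tensor [seq (g p.1, h p.2) | p <- repr t].

Definition tens_zero : tensor := \pi_tensor [::].
Definition tens_add (x y : tensor) : tensor := \pi_tensor (repr x ++ repr y).
Definition tens_opp : tensor -> tensor := tens_map -%R id.
Definition tens_scale (c : k) : tensor -> tensor := tens_map ( *:%R c) id.
Definition tens_lact (a : A) : tensor -> tensor := tens_map (lact a) id.
Definition tens_ract (t : tensor) (a : A) : tensor := tens_map id (ract^~ a) t.

Lemma tens_add_pi s t :
  tens_add (\pi_tensor s) (\pi_tensor t) = \pi_tensor (s ++ t).
Proof. by apply/tens_piP/TensCat; exact: tens_reprP. Qed.

Lemma tens_addA : associative tens_add.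
Proof.
move=> x y z; rewrite -(reprK x) -(reprK y) -(reprK z).
by rewrite (tens_add_pi (repr y)) !(tens_add_pi (repr x)) tens_add_pi catA.
Qed.
Lemma tens_addC : commutative tens_add.
Proof.
move=> x y; rewrite -(reprK x) -(reprK y) !tens_add_pi.
by apply/tens_piP/TensCatC.
Qed.
Lemma tens_add0 : left_id tens_zero tens_add.
Proof. by move=> x; rewrite -(reprK x) tens_add_pi. Qed.

HB.instance Definition _ :=
  GRing.isNmodule.Build tensor tens_addA tens_addC tens_add0.

Lemma tens_piD s t : \pi_tensor (s ++ t) = \pi_tensor s + \pi_tensor t.
Proof. by rewrite [RHS]tens_add_pi. Qed.

Lemma pi_sum_tens (s : seq (M * N)) :
  \pi_tensor s = \sum_(p <- s) tens p.1 p.2.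
Proof.
elim: s => [|[m n] s IH]; first by rewrite big_nil.
by rewrite big_cons -IH /= -tens_piD.
Qed.

Lemma tens_sumE (t : tensor) : t = \sum_(p <- repr t) tens p.1 p.2.
Proof. by rewrite -pi_sum_tens reprK. Qed.

Lemma tensDl m m' n : tens (m + m') n = tens m n + tens m' n.
Proof. by rewrite -tens_piD; apply/tens_piP/TensDl. Qed.
Lemma tensDr m n n' : tens m (n + n') = tens m n + tens m n'.
Proof. by rewrite -tens_piD; apply/tens_piP/TensDr. Qed.
Lemma tens0l n : tens 0 n = 0.
Proof. by apply/tens_piP/Tens0. Qed.
Lemma tensA m a n : tens (m ◁ a) n = tens m (a ▷ n).
Proof. by apply/tens_piP/TensBal. Qed.

Lemma tens0r m : tens m 0 = 0.
Proof. by rewrite -(lact0l 0) -tensA ract0r tens0l. Qed.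

Lemma tens_balanced : balanced tens.
Proof. by split; [exact: tensDl|exact: tensDr|exact: tens0l|exact: tensA]. Qed.

Lemma tens_ind (P : tensor -> Prop) :
  P 0 -> (forall x y, P x -> P y -> P (x + y)) -> (forall m n, P (tens m n)) ->
  forall t, P t.
Proof.
move=> P0 PD Pt t; rewrite (tens_sumE t).
by elim/big_ind: _ => // p _; exact: Pt.
Qed.

Lemma tliftD (V : nmodType) (f : M -> N -> V) : balanced f ->
  {morph tlift f : x y / x + y}.
Proof.
move=> bf x y; rewrite -(reprK x) -(reprK y) -tens_piD !tlift_pi //.
by rewrite big_cat.
Qed.
Lemma tlift0 (V : nmodType) (f : M -> N -> V) : balanced f -> tlift f 0 = 0.
Proof. by move=> bf; rewrite tlift_pi // big_nil. Qed.

Lemma tens_mapE g h t : tens_map g h t = tlift (fun m n => tens (g m) (h n)) t.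
Proof. by rewrite /tens_map pi_sum_tens big_map. Qed.

Section Map.
Variables (g : M -> M) (h : N -> N).
Hypotheses (gD : {morph g : x y / x + y}) (hD : {morph h : x y / x + y}).
Hypotheses (g0 : g 0 = 0).
Hypothesis (gh : forall m a n, tens (g (m ◁ a)) (h n) = tens (g m) (h (a ▷ n))).

Let bal : balanced (fun m n => tens (g m) (h n)).
Proof.
split=> *; rewrite ?gD ?hD ?tensDl ?tensDr ?g0 ?tens0l //; exact: gh.
Qed.
Lemma tens_map_tens m n : tens_map g h (tens m n) = tens (g m) (h n).
Proof. by rewrite tens_mapE tlift_tens. Qed.
Lemma tens_mapD : {morph tens_map g h : x y / x + y}.
Proof. by move=> x y; rewrite !tens_mapE tliftD. Qed.
Lemma tens_map0 : tens_map g h 0 = 0.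
Proof. by rewrite tens_mapE tlift0. Qed.
End Map.

Lemma tens_opp_tens m n : tens_opp (tens m n) = tens (- m) n.
Proof.
rewrite /tens_opp tens_map_tens ?oppr0 //; first exact: opprD.
by move=> x a y; rewrite -tensA -scaleN1r -ractZ scaleN1r.
Qed.
Lemma tens_oppD : {morph tens_opp : x y / x + y}.
Proof.
apply: tens_mapD; rewrite ?oppr0 //; first exact: opprD.
by move=> x a y; rewrite -tensA -scaleN1r -ractZ scaleN1r.
Qed.
Lemma tens_opp0 : tens_opp 0 = 0.
Proof.
apply: tens_map0; rewrite ?oppr0 //; first exact: opprD.
by move=> x a y; rewrite -tensA -scaleN1r -ractZ scaleN1r.
Qed.

Lemma tens_addN : left_inverse 0 tens_opp +%R.
Proof.
elim/tens_ind => [|x y IHx IHy|m n]; first by rewrite tens_opp0 addr0.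
- by rewrite tens_oppD addrACA IHx IHy addr0.
- by rewrite tens_opp_tens -tensDl addNr tens0l.
Qed.

HB.instance Definition _ := GRing.Nmodule_isZmodule.Build tensor tens_addN.

Section Actions.
Lemma tens_scale_tens c m n : tens_scale c (tens m n) = tens (c *: m) n.
Proof.
rewrite /tens_scale tens_map_tens ?scaler0 //; first exact: scalerDr.
by move=> x a y; rewrite -tensA ractZ.
Qed.
Lemma tens_scaleD c : {morph tens_scale c : x y / x + y}.
Proof.
apply: tens_mapD; rewrite ?scaler0 //; first exact: scalerDr.
by move=> x a y; rewrite -tensA ractZ.
Qed.
Lemma tens_scale0 c : tens_scale c 0 = 0.
Proof.
apply: tens_map0; rewrite ?scaler0 //; first exact: scalerDr.
by move=> x a y; rewrite -tensA ractZ.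
Qed.
Lemma tens_lact_tens a m n : tens_lact a (tens m n) = tens (a ▷ m) n.
Proof.
rewrite /tens_lact tens_map_tens ?lact0 //; first exact: lactDr.
by move=> x b y; rewrite -tensA lractA.
Qed.
Lemma tens_lactD a : {morph tens_lact a : x y / x + y}.
Proof.
apply: tens_mapD; rewrite ?lact0 //; first exact: lactDr.
by move=> x b y; rewrite -tensA lractA.
Qed.
Lemma tens_lact0 a : tens_lact a 0 = 0.
Proof.
apply: tens_map0; rewrite ?lact0 //; first exact: lactDr.
by move=> x b y; rewrite -tensA lractA.
Qed.
Lemma tens_ract_tens m n a : tens_ract (tens m n) a = tens m (n ◁ a).
Proof.
rewrite /tens_ract tens_map_tens //; first by move=> x y; exact: ractDl.
by move=> x b y; rewrite tensA lractA.
Qed.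
Lemma tens_ractD a : {morph tens_ract^~ a : x y / x + y}.
Proof.
apply: tens_mapD => //; first by move=> x y; exact: ractDl.
by move=> x b y; rewrite tensA lractA.
Qed.
Lemma tens_ract0 a : tens_ract 0 a = 0.
Proof.
apply: tens_map0 => //; first by move=> x y; exact: ractDl.
by move=> x b y; rewrite tensA lractA.
Qed.
End Actions.

Lemma tens_scaleA c d t : tens_scale c (tens_scale d t) = tens_scale (c * d) t.
Proof.
elim/tens_ind: t => [|x y IHx IHy|m n].
- by rewrite !tens_scale0.
- by rewrite !tens_scaleD IHx IHy.
- by rewrite !tens_scale_tens scalerA.
Qed.
Lemma tens_scale1 : left_id 1 tens_scale.
Proof.
elim/tens_ind => [|x y IHx IHy|m n].
- by rewrite !tens_scale0.
- by rewrite !tens_scaleD IHx IHy.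
- by rewrite !tens_scale_tens scale1r.
Qed.
Lemma tens_scaleDr : right_distributive tens_scale +%R.
Proof. by move=> c x y; exact: tens_scaleD. Qed.
Lemma tens_scaleDl t : {morph tens_scale^~ t : c d / c + d}.
Proof.
move=> c d; elim/tens_ind: t => [|x y IHx IHy|m n].
- by rewrite !tens_scale0 addr0.
- by rewrite !tens_scaleD IHx IHy addrACA.
- by rewrite !tens_scale_tens scalerDl tensDl.
Qed.

HB.instance Definition _ := GRing.Zmodule_isLmodule.Build k tensor
  tens_scaleA tens_scale1 tens_scaleDr tens_scaleDl.

Lemma tens_bimodule : is_bimodule tens_lact tens_ract.
Proof.
split.
- move=> a b; elim/tens_ind => [|x y IHx IHy|m n].
  + by rewrite !tens_lact0 addr0.
  + by rewrite !tens_lactD IHx IHy addrACA.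
  + by rewrite !tens_lact_tens lactDl tensDl.
- exact: tens_lactD.
- move=> a b; elim/tens_ind => [|x y IHx IHy|m n].
  + by rewrite !tens_lact0.
  + by rewrite !tens_lactD IHx IHy.
  + by rewrite !tens_lact_tens lactM.
- elim/tens_ind => [|x y IHx IHy|m n].
  + by rewrite !tens_lact0.
  + by rewrite !tens_lactD IHx IHy.
  + by rewrite !tens_lact_tens lact1.
- by move=> x y a; exact: tens_ractD.
- move=> t a b; elim/tens_ind: t => [|x y IHx IHy|m n].
  + by rewrite !tens_ract0 addr0.
  + by rewrite !tens_ractD IHx IHy addrACA.
  + by rewrite !tens_ract_tens ractDr tensDr.
- move=> t a b; elim/tens_ind: t => [|x y IHx IHy|m n].
  + by rewrite !tens_ract0.
  + by rewrite !tens_ractD IHx IHy.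
  + by rewrite !tens_ract_tens ractM.
- elim/tens_ind => [|x y IHx IHy|m n].
  + by rewrite !tens_ract0.
  + by rewrite !tens_ractD IHx IHy.
  + by rewrite !tens_ract_tens ract1.
- move=> a t b; elim/tens_ind: t => [|x y IHx IHy|m n].
  + by rewrite tens_lact0 tens_ract0 tens_lact0.
  + by rewrite tens_lactD !tens_ractD tens_lactD IHx IHy.
  + by rewrite tens_lact_tens !tens_ract_tens tens_lact_tens.
- move=> c; elim/tens_ind => [|x y IHx IHy|m n].
  + by rewrite tens_lact0 scaler0.
  + by rewrite tens_lactD scalerDr IHx IHy.
  + by rewrite tens_lact_tens lactA [RHS]tens_scale_tens.
- move=> c; elim/tens_ind => [|x y IHx IHy|m n].
  + by rewrite tens_ract0 scaler0.
  + by rewrite tens_ractD scalerDr IHx IHy.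
  + by rewrite tens_ract_tens ractA [RHS]tens_scale_tens -lactA -tensA ractA.
Qed.

HB.instance Definition _ :=
  Lmodule_isBimodule.Build k A tensor tens_bimodule.

Lemma tensZl c m n : tens (c *: m) n = c *: tens m n.
Proof. by rewrite [RHS]tens_scale_tens. Qed.
Lemma tensZr c m n : tens m (c *: n) = c *: tens m n.
Proof. by rewrite -lactA -tensA ractA tensZl. Qed.
Lemma lact_tens a m n : a ▷ tens m n = tens (a ▷ m) n.
Proof. exact: tens_lact_tens. Qed.
Lemma ract_tens m n a : tens m n ◁ a = tens m (n ◁ a).
Proof. exact: tens_ract_tens. Qed.

End TensorDef.

Arguments tens {k A M N} m n.
Notation "M ⊗ N" := (tensor M N) : type_scope.
Notation "m ⊗ n" := (tens m n) : ring_scope.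

Section TensorMaps.
Variables (k : fieldType) (A : algType k).

Lemma eq_tlift (M N : bimodType A) (V : nmodType) (f g : M -> N -> V) t :
  (forall m n, f m n = g m n) -> tlift f t = tlift g t.
Proof. by move=> fg; apply: eq_bigr => p _. Qed.

Lemma tlift_add (M N : bimodType A) (V : nmodType) (f g : M -> N -> V) t :
  tlift (fun m n => f m n + g m n) t = tlift f t + tlift g t.
Proof. exact: big_split. Qed.

Lemma tlift_zero (M N : bimodType A) (V : nmodType) t :
  tlift (fun (_ : M) (_ : N) => (0 : V)) t = 0.
Proof. exact: big1. Qed.

Lemma tlift_hom (M N P : bimodType A) (f : M -> N -> P) : balanced f ->
  (forall a m n, f (a ▷ m) n = a ▷ f m n) ->
  (forall m n a, f m (n ◁ a) = f m n ◁ a) ->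
  bimod_hom (tlift f).
Proof.
move=> bf fl fr.
have L a t : tlift f (a ▷ t) = a ▷ tlift f t.
  elim/tens_ind: t => [|x y IHx IHy|m n].
  - by rewrite lact0 tlift0 // lact0.
  - by rewrite lactDr !tliftD // IHx IHy lactDr.
  - by rewrite lact_tens !tlift_tens.
split=> //.
- by move=> c x y; rewrite tliftD // -lactA L lactA.
- move=> t a; elim/tens_ind: t => [|x y IHx IHy|m n].
  + by rewrite ract0 tlift0 // ract0.
  + by rewrite ractDl !tliftD // IHx IHy ractDl.
  + by rewrite ract_tens !tlift_tens.
Qed.

Lemma bimod_hom_linE (M N : bimodType A) (f : M -> N) : bimod_hom f ->
  forall c x y, f (c *: x + y) = c *: f x + f y.
Proof. by case. Qed.

Lemma bimod_homD (M N : bimodType A) (f : M -> N) : bimod_hom f ->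
  {morph f : x y / x + y}.
Proof.
by move=> hf x y; have := bimod_map_linear hf 1 x y; rewrite !scale1r.
Qed.

Lemma bimod_hom0 (M N : bimodType A) (f : M -> N) : bimod_hom f -> f 0 = 0.
Proof. by move=> hf; rewrite -(lact0l 0) (bimod_map_l hf) lact0l. Qed.

Lemma bimod_hom_id (M : bimodType A) : bimod_hom (@id M).
Proof. by split. Qed.

Lemma bimod_hom_comp (M N P : bimodType A) (g : N -> P) (f : M -> N) :
  bimod_hom g -> bimod_hom f -> bimod_hom (g \o f).
Proof.
move=> hg hf; split=> /= [c x y|a v|v a].
- by rewrite /= (bimod_hom_linE hf) (bimod_hom_linE hg).
- by rewrite (bimod_map_l hf) (bimod_map_l hg).
- by rewrite (bimod_map_r hf) (bimod_map_r hg).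
Qed.

Definition tmap (M N M' N' : bimodType A) (f : M -> M') (g : N -> N') :
  (M ⊗ N)%type -> (M' ⊗ N')%type := tlift (fun m n => f m ⊗ g n).

Lemma tmap_balanced (M N M' N' : bimodType A) (f : M -> M') (g : N -> N') :
  bimod_hom f -> bimod_hom g -> balanced (fun m n => f m ⊗ g n).
Proof.
move=> hf hg; split=> *.
- by rewrite (bimod_homD hf) tensDl.
- by rewrite (bimod_homD hg) tensDr.
- by rewrite (bimod_hom0 hf) tens0l.
- by rewrite (bimod_map_r hf) (bimod_map_l hg) tensA.
Qed.

Lemma tmap_tens (M N M' N' : bimodType A) (f : M -> M') (g : N -> N') m n :
  bimod_hom f -> bimod_hom g -> tmap f g (m ⊗ n) = f m ⊗ g n.
Proof. by move=> hf hg; rewrite /tmap tlift_tens //; exact: tmap_balanced. Qed.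

Lemma tmap_hom (M N M' N' : bimodType A) (f : M -> M') (g : N -> N') :
  bimod_hom f -> bimod_hom g -> bimod_hom (tmap f g).
Proof.
move=> hf hg; apply: tlift_hom; first exact: tmap_balanced.
- by move=> a m n; rewrite (bimod_map_l hf) lact_tens.
- by move=> m n a; rewrite (bimod_map_r hg) ract_tens.
Qed.

Section Assoc.
Variables M N P : bimodType A.

Definition assocr : ((M ⊗ N) ⊗ P)%type -> (M ⊗ (N ⊗ P))%type :=
  tlift (fun t p => tlift (fun m n => m ⊗ (n ⊗ p)) t).
Definition assocl : (M ⊗ (N ⊗ P))%type -> ((M ⊗ N) ⊗ P)%type :=
  tlift (fun m t => tlift (fun n p => (m ⊗ n) ⊗ p) t).

Let bal_in_r (p : P) : balanced (fun (m : M) (n : N) => m ⊗ (n ⊗ p)).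
Proof.
split=> *; rewrite ?tensDl ?tensDr ?tens0l //.
by rewrite tensA lact_tens.
Qed.
Let bal_in_l (m : M) : balanced (fun (n : N) (p : P) => (m ⊗ n) ⊗ p).
Proof.
split=> *; rewrite ?tensDr ?tensDl ?tens0r ?tens0l //.
by rewrite -ract_tens tensA.
Qed.

Let tens3_out_r (t : (M ⊗ N)%type) a (p : P) :
  tlift (fun m n => m ⊗ (n ⊗ p)) (t ◁ a) =
  tlift (fun m n => m ⊗ (n ⊗ (a ▷ p))) t.
Proof.
elim/tens_ind: t => [|x y IHx IHy|m n].
- by rewrite ract0 !tlift0.
- by rewrite ractDl !tliftD // IHx IHy.
- by rewrite ract_tens !tlift_tens // tensA.
Qed.
Let tens3_out_l (t : (N ⊗ P)%type) a (m : M) :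
  tlift (fun n p => ((m ◁ a) ⊗ n) ⊗ p) t =
  tlift (fun n p => (m ⊗ n) ⊗ p) (a ▷ t).
Proof.
elim/tens_ind: t => [|x y IHx IHy|n p].
- by rewrite lact0 !tlift0.
- by rewrite lactDr !tliftD // IHx IHy.
- by rewrite lact_tens !tlift_tens // tensA.
Qed.

Let bal_out_r :
  balanced (fun (t : (M ⊗ N)%type) (p : P) =>
    tlift (fun m n => m ⊗ (n ⊗ p)) t).
Proof.
split=> [t t' p|t p p'|p|t a p]; first exact: tliftD.
- by rewrite -tlift_add; apply: eq_tlift => m n; rewrite !tensDr.
- exact: tlift0.
- exact: tens3_out_r.
Qed.
Let bal_out_l :
  balanced (fun (m : M) (t : (N ⊗ P)%type) =>
    tlift (fun n p => (m ⊗ n) ⊗ p) t).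
Proof.
split=> [m m' t|m t t'|t|m a t]; last exact: tens3_out_l.
- by rewrite -tlift_add; apply: eq_tlift => n p; rewrite !tensDl.
- exact: tliftD.
- rewrite -[RHS](tlift_zero _ t); apply: eq_tlift => n p.
  by rewrite !tens0l.
Qed.

Lemma assocr_tens (m : M) (n : N) (p : P) : assocr ((m ⊗ n) ⊗ p) = m ⊗ (n ⊗ p).
Proof. by rewrite /assocr !tlift_tens. Qed.
Lemma assocl_tens (m : M) (n : N) (p : P) : assocl (m ⊗ (n ⊗ p)) = (m ⊗ n) ⊗ p.
Proof. by rewrite /assocl !tlift_tens. Qed.

Lemma assocr_hom : bimod_hom assocr.
Proof.
apply: tlift_hom => // [a t p|t p a].
- elim/tens_ind: t => [|x y IHx IHy|m n].
  + by rewrite lact0 !tlift0 // lact0.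
  + by rewrite lactDr !tliftD // IHx IHy lactDr.
  + by rewrite lact_tens !tlift_tens // lact_tens.
- elim/tens_ind: t => [|x y IHx IHy|m n].
  + by rewrite !tlift0 // ract0.
  + by rewrite !tliftD // IHx IHy ractDl.
  + by rewrite !tlift_tens // !ract_tens.
Qed.
Lemma assocl_hom : bimod_hom assocl.
Proof.
apply: tlift_hom => // [a m t|m t a].
- elim/tens_ind: t => [|x y IHx IHy|n p].
  + by rewrite !tlift0 // lact0.
  + by rewrite !tliftD // IHx IHy lactDr.
  + by rewrite !tlift_tens // !lact_tens.
- elim/tens_ind: t => [|x y IHx IHy|n p].
  + by rewrite ract0 !tlift0 // ract0.
  + by rewrite ractDl !tliftD // IHx IHy ractDl.
  + by rewrite ract_tens !tlift_tens // ract_tens.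
Qed.

Lemma assocrK : cancel assocr assocl.
Proof.
have hr := assocr_hom; have hl := assocl_hom.
elim/tens_ind => [|x y IHx IHy|t p].
- by rewrite (bimod_hom0 hr) (bimod_hom0 hl).
- by rewrite (bimod_homD hr) (bimod_homD hl) IHx IHy.
- elim/tens_ind: t => [|x y IHx IHy|m n].
  + by rewrite tens0l (bimod_hom0 hr) (bimod_hom0 hl).
  + by rewrite tensDl (bimod_homD hr) (bimod_homD hl) IHx IHy.
  + by rewrite assocr_tens assocl_tens.
Qed.
Lemma assoclK : cancel assocl assocr.
Proof.
have hr := assocr_hom; have hl := assocl_hom.
elim/tens_ind => [|x y IHx IHy|m t].
- by rewrite (bimod_hom0 hl) (bimod_hom0 hr).
- by rewrite (bimod_homD hl) (bimod_homD hr) IHx IHy.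
- elim/tens_ind: t => [|x y IHx IHy|n p].
  + by rewrite tens0r (bimod_hom0 hl) (bimod_hom0 hr).
  + by rewrite tensDr (bimod_homD hl) (bimod_homD hr) IHx IHy.
  + by rewrite assocl_tens assocr_tens.
Qed.
End Assoc.

(* A map on two tensor factors applied in positions 1,2 or 2,3 of a triple
   tensor product, which is always bracketed to the right. *)
Definition on12 (M N M' N' P : bimodType A)
    (f : (M ⊗ N)%type -> (M' ⊗ N')%type) :
    (M ⊗ (N ⊗ P))%type -> (M' ⊗ (N' ⊗ P))%type :=
  fun t => assocr (tmap f id (assocl t)).
Definition on23 (M N P N' P' : bimodType A)
    (f : (N ⊗ P)%type -> (N' ⊗ P')%type) :
    (M ⊗ (N ⊗ P))%type -> (M ⊗ (N' ⊗ P'))%type :=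
  tmap id f.

Lemma on12_hom (M N M' N' P : bimodType A)
    (f : (M ⊗ N)%type -> (M' ⊗ N')%type) :
  bimod_hom f -> bimod_hom (@on12 _ _ _ _ P f).
Proof.
move=> hf; apply: (bimod_hom_comp (assocr_hom _ _ _)).
apply: (bimod_hom_comp _ (assocl_hom _ _ _)).
exact: tmap_hom (bimod_hom_id _).
Qed.
Lemma on23_hom (M N P N' P' : bimodType A)
    (f : (N ⊗ P)%type -> (N' ⊗ P')%type) :
  bimod_hom f -> bimod_hom (@on23 M _ _ _ _ f).
Proof. exact: tmap_hom (bimod_hom_id _). Qed.

End TensorMaps.

Section Subspace.
Variables (R : pzRingType) (V : lmodType R) (S : submodClosed V).

Record subspace := Subspace { subspace_val :> V; _ : subspace_val \in S }.

HB.instance Definition _ := [isSub for subspace_val].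
HB.instance Definition _ := [Choice of subspace by <:].
HB.instance Definition _ := [SubChoice_isSubLmodule of subspace by <:].

Lemma subspace_mem (x : subspace) : val x \in S.
Proof. exact: valP. Qed.

Lemma subspace_valD (x y : subspace) : val (x + y) = val x + val y.
Proof. by []. Qed.
Lemma subspace_valZ c (x : subspace) : val (c *: x) = c *: val x.
Proof. by []. Qed.

End Subspace.

(* The direct sum of the Ω^n is one algebra [dga_alg]; Ω^n is its subspace
   [dga_gr n], and Ω^0 is identified with A by [dga_in]. The product of
   [dga_alg] is the wedge product. *)
Record dga (k : fieldType) (A : algType k) := Dga {
  dga_alg : algType k;
  dga_in : {lrmorphism A -> dga_alg};
  dga_gr : nat -> submodClosed dga_alg;
  dga_d : {linear dga_alg -> dga_alg};
  dga_gr_span : forall x : dga_alg, exists (n : nat) (f : nat -> dga_alg),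
    (forall i, f i \in dga_gr i) /\ x = \sum_(i < n) f i;
  dga_gr_indep : forall (n : nat) (f : nat -> dga_alg),
    (forall i, f i \in dga_gr i) -> \sum_(i < n) f i = 0 ->
    forall i, (i < n)%N -> f i = 0;
  dga_grM : forall m n x y, x \in dga_gr m -> y \in dga_gr n ->
    x * y \in dga_gr (m + n);
  dga_in_inj : injective dga_in;
  dga_gr0 : forall x, x \in dga_gr 0 <-> exists a, x = dga_in a;
  dga_d_gr : forall n x, x \in dga_gr n -> dga_d x \in dga_gr n.+1;
  dga_dd : forall x, dga_d (dga_d x) = 0;
  dga_leibniz : forall n x y, x \in dga_gr n ->
    dga_d (x * y) = dga_d x * y + (-1) ^+ n * (x * dga_d y);
  dga_gen : forall S : {pred dga_alg}, GRing.subalg_closed S ->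
    (forall a, dga_in a \in S) -> (forall a, dga_d (dga_in a) \in S) ->
    forall x, x \in S
}.

Section Forms.
Variables (k : fieldType) (A : algType k) (D : dga A).

Definition Omega (n : nat) : Type := subspace (dga_gr D n).

HB.instance Definition _ n := GRing.Lmodule.on (Omega n).

Section Degree.
Variable n : nat.

Lemma Omega_lact_subproof (a : A) (w : Omega n) :
  dga_in D a * val w \in dga_gr D n.
Proof.
by apply: (dga_grM (m := 0)) (subspace_mem w); apply/dga_gr0; exists a.
Qed.
Lemma Omega_ract_subproof (w : Omega n) (a : A) :
  val w * dga_in D a \in dga_gr D n.
Proof.
have a0 : dga_in D a \in dga_gr D 0 by apply/dga_gr0; exists a.
by have := dga_grM (subspace_mem w) a0; rewrite addn0.
Qed.

Definition Omega_lact (a : A) (w : Omega n) : Omega n :=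
  Subspace (Omega_lact_subproof a w).
Definition Omega_ract (w : Omega n) (a : A) : Omega n :=
  Subspace (Omega_ract_subproof w a).

Lemma Omega_bimodule : is_bimodule Omega_lact Omega_ract.
Proof.
split=> *; apply: val_inj; rewrite /= ?subspace_valD ?subspace_valZ /=.
- by rewrite raddfD mulrDl.
- by rewrite mulrDr.
- by rewrite rmorphM mulrA.
- by rewrite rmorph1 mul1r.
- by rewrite mulrDl.
- by rewrite raddfD mulrDr.
- by rewrite rmorphM mulrA.
- by rewrite rmorph1 mulr1.
- by rewrite mulrA.
- by rewrite linearZ rmorph1 /= mulr_algl.
- by rewrite linearZ rmorph1 /= mulr_algr.
Qed.

HB.instance Definition _ :=
  Lmodule_isBimodule.Build k A (Omega n) Omega_bimodule.

Lemma Omega_d_subproof (w : Omega n) : dga_d D (val w) \in dga_gr D n.+1.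
Proof. exact: dga_d_gr (subspace_mem w). Qed.
Definition Omega_d (w : Omega n) : Omega n.+1 := Subspace (Omega_d_subproof w).

End Degree.

Lemma Omega_d0_subproof (a : A) : dga_d D (dga_in D a) \in dga_gr D 1.
Proof. by apply: dga_d_gr; apply/dga_gr0; exists a. Qed.
Definition Omega_d0 (a : A) : Omega 1 := Subspace (Omega_d0_subproof a).

Lemma Omega_mul_subproof m n (w : Omega m) (h : Omega n) :
  val w * val h \in dga_gr D (m + n).
Proof. exact: dga_grM (subspace_mem w) (subspace_mem h). Qed.
Definition Omega_mul m n (w : Omega m) (h : Omega n) : Omega (m + n) :=
  Subspace (Omega_mul_subproof w h).

Local Notation d := Omega_d0.
Local Notation O1 := (Omega 1).
Local Notation O2 := (Omega 2).
Local Notation T2 := (O1 ⊗ O1)%type.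
Local Notation T3 := (O1 ⊗ (O1 ⊗ O1))%type.

Definition wedge11 (w h : O1) : O2 := @Omega_mul 1 1 w h.

Definition wedge : T2 -> O2 := tlift wedge11.

(* ∧ in positions 1,2 and 2,3 of Ω^1 ⊗ Ω^1 ⊗ N *)
Definition wedge12 (N : bimodType A) (t : (O1 ⊗ (O1 ⊗ N))%type) :
  (O2 ⊗ N)%type := tmap wedge id (assocl t).
Definition wedge23 (t : T3) : (O1 ⊗ O2)%type := tmap id wedge t.

Lemma wedge_balanced : balanced wedge11.
Proof.
split=> *; apply: val_inj; rewrite /= ?subspace_valD.
- by rewrite mulrDl.
- by rewrite mulrDr.
- by rewrite mul0r.
- by rewrite mulrA.
Qed.
Lemma wedge_tens (w h : O1) : wedge (w ⊗ h) = wedge11 w h.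
Proof. exact: tlift_tens wedge_balanced. Qed.
Lemma wedge_hom : bimod_hom wedge.
Proof.
apply: tlift_hom; first exact: wedge_balanced.
- by move=> a w h; apply: val_inj; rewrite /= mulrA.
- by move=> w h a; apply: val_inj; rewrite /= mulrA.
Qed.
Lemma wedge12_hom N : bimod_hom (@wedge12 N).
Proof.
apply: bimod_hom_comp (assocl_hom _ _ _).
exact: tmap_hom wedge_hom (bimod_hom_id _).
Qed.
Lemma wedge23_hom : bimod_hom wedge23.
Proof. exact: tmap_hom (bimod_hom_id _) wedge_hom. Qed.

Record bimod_connection (E : bimodType A) (nabla : E -> (O1 ⊗ E)%type)
    (sigma : (E ⊗ O1)%type -> (O1 ⊗ E)%type) : Prop := BimodConnection {
  conn_linear : linear nabla;
  conn_sigma : bimod_hom sigma;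
  conn_left : forall a e, nabla (a ▷ e) = d a ⊗ e + a ▷ nabla e;
  conn_right : forall e a, nabla (e ◁ a) = nabla e ◁ a + sigma (e ⊗ d a)
}.

Section Connection.
Variables (nabla : O1 -> T2) (sigma : T2 -> T2).

Definition sigma1 : T3 -> T3 := on12 sigma.
Definition sigma2 : T3 -> T3 := on23 sigma.

Definition nabla2 : T2 -> T3 :=
  tlift (fun w h : O1 => assocr (nabla w ⊗ h) + sigma1 (w ⊗ nabla h)).

Definition torsion_free : Prop := forall w, wedge (nabla w) = Omega_d w.

(* d ⊗ id - id ∧ ∇ *)
Definition d_id_nabla : T2 -> (O2 ⊗ O1)%type :=
  tlift (fun w h : O1 => (Omega_d w : O2) ⊗ h - wedge12 (w ⊗ nabla h)).

Definition flat : Prop := forall w, d_id_nabla (nabla w) = 0.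

Definition wedge_compatible : Prop :=
  exists (nablaO2 : O2 -> (O1 ⊗ O2)%type)
         (sigmaO2 : (O2 ⊗ O1)%type -> (O1 ⊗ O2)%type),
    bimod_connection nablaO2 sigmaO2 /\
    forall h w : O1, nablaO2 (wedge (h ⊗ w)) =
      wedge23 (assocr (nabla h ⊗ w)) + wedge23 (sigma1 (h ⊗ nabla w)).

Definition extendable : Prop :=
  exists tau : (O1 ⊗ O2)%type -> (O2 ⊗ O1)%type,
    bimod_hom tau /\
    forall w h z : O1, tau (w ⊗ wedge (h ⊗ z)) =
      wedge12 (sigma2 (sigma1 (w ⊗ (h ⊗ z)))).

Definition leibniz_compatible : Prop :=
  forall t : T2, nabla2 (sigma t) = sigma2 (nabla2 t).

Definition br2 (t : T2) : T2 := t + sigma t.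
Definition br3 (t : T3) : T3 := t + sigma2 t + sigma1 (sigma2 t).
Definition br3' (t : T3) : T3 := t + sigma1 t + sigma2 (sigma1 t).

Section WellDefined.
Hypothesis conn : bimod_connection nabla sigma.

Let nablaD : {morph nabla : x y / x + y}.
Proof. by move=> x y; have := conn_linear conn 1 x y; rewrite !scale1r. Qed.
Let nabla0 : nabla 0 = 0.
Proof. by apply: (addIr (nabla 0)); rewrite -nablaD !add0r. Qed.
Let s1_hom : bimod_hom sigma1.
Proof. exact: on12_hom (conn_sigma conn). Qed.

Lemma nabla2_tens (w h : O1) :
  nabla2 (w ⊗ h) = assocr (nabla w ⊗ h) + sigma1 (w ⊗ nabla h).
Proof.
have ar := assocr_hom (A := A) O1 O1 O1.
rewrite /nabla2 tlift_tens //; split=> [w1 w2 e|e e1 e2|e|e a f].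
- by rewrite nablaD !tensDl (bimod_homD ar) (bimod_homD s1_hom) addrACA.
- by rewrite nablaD !tensDr (bimod_homD ar) (bimod_homD s1_hom) addrACA.
- by rewrite nabla0 !tens0l (bimod_hom0 ar) (bimod_hom0 s1_hom) addr0.
- rewrite (conn_right conn) (conn_left conn) tensDl tensDr.
  rewrite (bimod_homD ar) (bimod_homD s1_hom) (tensA (nabla e)) (tensA e).
  rewrite -addrA; congr (_ + (_ + _)).
  by rewrite /sigma1 /on12 assocl_tens tmap_tens //; case: conn.
Qed.

Lemma d_id_nabla_tens (w h : O1) :
  d_id_nabla (w ⊗ h) = (Omega_d w : O2) ⊗ h - wedge12 (w ⊗ nabla h).
Proof.
have w12 := @wedge12_hom O1.
have dD (x y : O1) : Omega_d (x + y) = Omega_d x + Omega_d y.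
  by apply: val_inj; rewrite /= linearD.
rewrite /d_id_nabla tlift_tens //; split=> [w1 w2 e|e e1 e2|e|e a f].
- by rewrite dD !tensDl (bimod_homD w12) opprD addrACA.
- by rewrite nablaD !tensDr (bimod_homD w12) opprD addrACA.
- rewrite (_ : Omega_d 0 = 0) ?tens0l ?(bimod_hom0 w12) ?subr0 //.
  by apply: val_inj; rewrite /= linear0.
- have -> : Omega_d (e ◁ a) = Omega_d e ◁ a - wedge11 e (d a).
    apply: val_inj; rewrite /= (dga_leibniz _ (subspace_mem e)).
    by rewrite expr1 mulN1r.
  rewrite (conn_left conn) tensDr (bimod_homD w12) opprD addrA.
  rewrite -!tensA tensDl; congr (_ + _ - _).
  rewrite /wedge12 assocl_tens tmap_tens ?wedge_tens //; last exact: wedge_hom.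
  by rewrite -scaleN1r tensZl scaleN1r.
Qed.

End WellDefined.
End Connection.

(* Ω^2_S and Ω^3_S *)
Definition sym2 : {pred T2} := [pred t | wedge t == 0].
Definition sym3 : {pred T3} := [pred t | (wedge12 t == 0) && (wedge23 t == 0)].

Lemma sym2E t : (t \in sym2) = (wedge t == 0).
Proof. by []. Qed.
Lemma sym3E t : (t \in sym3) = (wedge12 t == 0) && (wedge23 t == 0).
Proof. by []. Qed.

Lemma sym2_submod : GRing.subsemimod_closed sym2.
Proof.
have hw := wedge_hom; split; [split=> [|x y]|move=> c x]; rewrite !sym2E.
- by rewrite (bimod_hom0 hw).
- by move=> /eqP x0 /eqP y0; rewrite (bimod_homD hw) x0 y0 addr0.
- by rewrite -lactA (bimod_map_l hw) => /eqP ->; rewrite lact0.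
Qed.
Lemma sym3_submod : GRing.subsemimod_closed sym3.
Proof.
have h1 := @wedge12_hom O1; have h2 := wedge23_hom.
split; [split=> [|x y]|move=> c x]; rewrite !sym3E.
- by rewrite (bimod_hom0 h1) (bimod_hom0 h2) !eqxx.
- move=> /andP[/eqP x0 /eqP x1] /andP[/eqP y0 /eqP y1].
  by rewrite (bimod_homD h1) (bimod_homD h2) x0 x1 y0 y1 !addr0 !eqxx.
- rewrite -lactA (bimod_map_l h1) (bimod_map_l h2).
  by move=> /andP[/eqP -> /eqP ->]; rewrite !lact0 !eqxx.
Qed.

HB.instance Definition _ := GRing.isSubmodClosed.Build k T2 sym2 sym2_submod.
HB.instance Definition _ := GRing.isSubmodClosed.Build k T3 sym3 sym3_submod.

Definition Jet2 : Type := (A * O1 * subspace sym2)%type.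
Definition Jet3 : Type := (Jet2 * subspace sym3)%type.

Definition pi3 (x : Jet3) : Jet2 := x.1.

HB.instance Definition _ := GRing.Lmodule.on Jet2.
HB.instance Definition _ := GRing.Lmodule.on Jet3.

(* The actions are given by formulas in the ambient spaces
   A ⊕ Ω^1 ⊕ Ω^1⊗Ω^1 and A ⊕ Ω^1 ⊕ Ω^1⊗Ω^1 ⊕ Ω^1⊗Ω^1⊗Ω^1. *)
Definition Amb2 : Type := (A * O1 * T2)%type.
Definition Amb3 : Type := (Amb2 * T3)%type.

Definition jet2_amb (x : Jet2) : Amb2 := (x.1.1, x.1.2, val x.2).
Definition jet3_amb (x : Jet3) : Amb3 := (jet2_amb x.1, val x.2).

Section JetActions.
Variables (nabla : O1 -> T2) (sigma : T2 -> T2).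

Definition j2_amb (s : A) : Amb2 := (s, d s, nabla (d s)).
Definition j3_amb (s : A) : Amb3 :=
  (j2_amb s, nabla2 nabla sigma (nabla (d s))).

(* Each component is the sum of the contributions of the summands
   s, w, t (= ω^1 ⊗ ω^2) and u (= ω^1 ⊗ ω^2 ⊗ ω^3) of the argument. *)
Definition lact2 (a : A) (x : Amb2) : Amb2 :=
  let: (s, w, t) := x in
  (a * s,
   d a ◁ s + a ▷ w,
   nabla (d a) ◁ s + br2 sigma (d a ⊗ w) + a ▷ t).

Definition ract2 (x : Amb2) (a : A) : Amb2 :=
  let: (s, w, t) := x in
  (s * a,
   s ▷ d a + w ◁ a,
   s ▷ nabla (d a) + br2 sigma (w ⊗ d a) + t ◁ a).

Definition lact3 (a : A) (x : Amb3) : Amb3 :=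
  let: (s, w, t, u) := x in
  (lact2 a (s, w, t),
   nabla2 nabla sigma (nabla (d a)) ◁ s
   + br3 sigma (assocr (nabla (d a) ⊗ w))
   + br3' sigma (d a ⊗ t)
   + a ▷ u).

Definition ract3 (x : Amb3) (a : A) : Amb3 :=
  let: (s, w, t, u) := x in
  (ract2 (s, w, t) a,
   s ▷ nabla2 nabla sigma (nabla (d a))
   + br3' sigma (w ⊗ nabla (d a))
   + br3 sigma (assocr (t ⊗ d a))
   + u ◁ a).

End JetActions.
End Forms.

(* Main.v *)
Require Import Defs.
From HB Require Import structures.
From mathcomp Require Import all_boot all_order all_algebra.
From mathcomp Require Import boolp.
Import GRing.Theory.
Local Open Scope ring_scope.

Set Implicit Arguments.
Unset Strict Implicit.
Unset Printing Implicit Defensive.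

(** The bimodule identities all reduce to the associativity of one product.
    On A ⊕ Ω^1 ⊕ Ω^1⊗Ω^1 ⊕ Ω^1⊗Ω^1⊗Ω^1 consider the braided
    shuffle product, truncated above degree 3: degree 0 acts by the bimodule
    actions, and the components (1,1), (1,2), (2,1) are the braided binomials
    [2,σ], [3,σ]', [3,σ].  Then a • x = j(a) x and x • a = x j(a), where j is
    the jet prolongation, so everything follows as soon as the product is
    associative and j is a unital algebra map: the bimodule laws are
    associativity, and j is a bimodule map because it is multiplicative.

    Associativity only has content in the component (1,1,1), where it reads
    [3,σ]([2,σ] ⊗ id) = [3,σ]'(id ⊗ [2,σ]).  Expanding both sides, this is the
    braid relation for σ ([br3_shuffle], [braid]).  The braid relation comes
    from Leibniz compatibility: comparing ∇_2 σ = σ_2 ∇_2 on t and on t a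
    isolates the σ-terms of ∇_2 (t a), and Ω^1 is spanned by the forms da b.
    Multiplicativity of j in degree 3 is a direct computation of
    ∇_2 ∇ d(ab), where Leibniz compatibility moves ∇_2 past σ.

    The symmetric tensors form a subspace closed under this product.  Torsion
    freeness gives ∧σ = -∧, so ∧_1 kills id + σ_1 and ∧_2 kills id + σ_2; what
    remains of ∧_2 [3,σ] and of ∧_1 [3,σ]' factors through ∧ on the first two,
    respectively last two, factors, by ∧-compatibility and by extendability
    ([br3_sym], [br3'_sym]).  Finally j takes symmetric values: ∧∇da = dda = 0,
    while ∧_1 ∇_2 = d ⊗ id - id ∧ ∇ vanishes on ∇da by flatness, and
    ∧_2 ∇_2 = ∇_{Ω^2} ∧ vanishes there by the previous equation
    ([nabla2_nabla_d_sym]). *)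

(** * Bimodule maps out of tensor products *)

Section Homs.
Variables (k : fieldType) (A : algType k).

Lemma zero_hom (M N : bimodType A) : bimod_hom (fun _ : M => 0 : N).
Proof. by split=> [c x y|a v|v a]; rewrite ?scaler0 ?addr0 ?lact0 ?ract0. Qed.

Lemma add_hom (M N : bimodType A) (f g : M -> N) :
  bimod_hom f -> bimod_hom g -> bimod_hom (fun x => f x + g x).
Proof.
move=> hf hg; split=> [c x y|a v|v a].
- by rewrite (bimod_hom_linE hf) (bimod_hom_linE hg) scalerDr addrACA.
- by rewrite (bimod_map_l hf) (bimod_map_l hg) lactDr.
- by rewrite (bimod_map_r hf) (bimod_map_r hg) ractDl.
Qed.

Lemma hom_ext (M N P : bimodType A) (f g : (M ⊗ N)%type -> P) :
  bimod_hom f -> bimod_hom g -> (forall m n, f (m ⊗ n) = g (m ⊗ n)) -> f =1 g.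
Proof.
move=> hf hg fg; elim/tens_ind => [|x y IHx IHy|//].
- by rewrite (bimod_hom0 hf) (bimod_hom0 hg).
- by rewrite (bimod_homD hf) (bimod_homD hg) IHx IHy.
Qed.

Lemma on12_assocr (M N M' N' P : bimodType A)
    (f : (M ⊗ N)%type -> (M' ⊗ N')%type) t (p : P) :
  bimod_hom f -> on12 f (assocr (t ⊗ p)) = assocr (f t ⊗ p).
Proof.
by move=> hf; rewrite /on12 assocrK tmap_tens //; exact: bimod_hom_id.
Qed.

Lemma on23_tens (M N P N' P' : bimodType A)
    (f : (N ⊗ P)%type -> (N' ⊗ P')%type) (m : M) t :
  bimod_hom f -> on23 f (m ⊗ t) = m ⊗ f t.
Proof.
by move=> hf; rewrite /on23 tmap_tens //; exact: bimod_hom_id.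
Qed.

End Homs.

(** * One-forms are spanned by the forms da b *)

Section Span.
Variables (k : fieldType) (A : algType k) (D : dga A).
Local Notation O1 := (Omega D 1).
Local Notation d := (Omega_d0 D).

Lemma d0D a b : d (a + b) = d a + d b.
Proof. by apply: val_inj; rewrite /= !linearD. Qed.
Lemma d0Z c a : d (c *: a) = c *: d a.
Proof. by apply: val_inj; rewrite /= !linearZ. Qed.
Lemma d0M a b : d (a * b) = d a ◁ b + a ▷ d b.
Proof.
apply: val_inj; rewrite /= rmorphM (@dga_leibniz _ _ D 0) ?mul1r //.
by apply/dga_gr0; exists a.
Qed.
Lemma d0_1 : d 1 = 0.
Proof.
have := d0M 1 1; rewrite mulr1 ract1 lact1 => /eqP.
by rewrite -subr_eq subrr => /eqP <-.
Qed.

(** The free index [i] lets the degree of a product be given up to an equation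
    between natural numbers; a sum in the type of the conclusion would have to
    be matched syntactically. *)
Lemma gr_mul m n i (x y : dga_alg D) : (m + n)%N = i ->
  x \in dga_gr D m -> y \in dga_gr D n -> x * y \in dga_gr D i.
Proof. by move=> <-; exact: dga_grM. Qed.

Definition exact_span (w : O1) : Prop :=
  exists s : seq (A * A), w = \sum_(p <- s) d p.1 ◁ p.2.

Lemma exact_span0 : exact_span 0.
Proof. by exists [::]; rewrite big_nil. Qed.
Lemma exact_spanD u v : exact_span u -> exact_span v -> exact_span (u + v).
Proof. by move=> [s ->] [t ->]; exists (s ++ t); rewrite big_cat. Qed.
Lemma exact_span_d a : exact_span (d a).
Proof. by exists [:: (a, 1)]; rewrite big_seq1 ract1. Qed.
Lemma exact_spanr w a : exact_span w -> exact_span (w ◁ a).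
Proof.
move=> [s ->]; exists [seq (p.1, p.2 * a) | p <- s].
elim: s => [|p s IH]; first by rewrite !big_nil ract0.
by rewrite map_cons !big_cons ractDl IH ractM.
Qed.

(** By the Leibniz rule, a (db) = d(ab) - (da) b. *)
Lemma exact_spanl w a : exact_span w -> exact_span (a ▷ w).
Proof.
move=> [s ->]; elim: s => [|[b c] s IH].
  by rewrite big_nil lact0; exact: exact_span0.
rewrite big_cons lactDr /= -lractA.
apply: exact_spanD IH; apply: exact_spanr.
have -> : a ▷ d b = d (a * b) + d (- a) ◁ b.
  by rewrite d0M -scaleN1r d0Z ractZ scaleN1r addrC addKr.
apply: exact_spanD; first exact: exact_span_d.
by apply: exact_spanr; exact: exact_span_d.
Qed.

(** A polynomial whose i-th coefficient has degree i records a decomposition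
    into homogeneous components of its value at 1, and the product of
    polynomials is the product of such decompositions.  The values at 1 of the
    polynomials below thus form a subalgebra containing A and dA. *)
Definition spanned_poly (p : {poly dga_alg D}) : Prop :=
  (forall i, p`_i \in dga_gr D i) /\
  (exists2 w, exact_span w & p`_1 = val w).

Lemma spanned_polyD p q :
  spanned_poly p -> spanned_poly q -> spanned_poly (p + q).
Proof.
move=> [gp [u su pu]] [gq [v sv qv]]; split=> [i|].
  by rewrite coefD; apply: rpredD.
exists (u + v); first exact: exact_spanD.
by rewrite coefD pu qv.
Qed.

Lemma spanned_polyM p q :
  spanned_poly p -> spanned_poly q -> spanned_poly (p * q).
Proof.
move=> [gp [u su pu]] [gq [v sv qv]]; split=> [i|].
  rewrite coefM; apply: rpred_sum => j _.
  by apply: (gr_mul (m := j) (n := i - j)) => //; apply: subnKC; rewrite -ltnS.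
have /dga_gr0[a pa] := gp 0; have /dga_gr0[b qb] := gq 0.
exists (a ▷ v + u ◁ b); first by apply: exact_spanD;
  [exact: exact_spanl|exact: exact_spanr].
by rewrite coefM !big_ord_recl big_ord0 /= addr0 pa qb pu qv.
Qed.

(** Uniqueness of homogeneous components, for an element of degree 1. *)
Lemma form_coef1 (p : {poly dga_alg D}) (w : dga_alg D) :
  (forall i, p`_i \in dga_gr D i) -> w \in dga_gr D 1 -> p.[1] = w -> p`_1 = w.
Proof.
move=> gp gw pw; pose f i := p`_i - w *+ (i == 1)%N.
have gf i : f i \in dga_gr D i.
  rewrite /f -scaleN1r; apply: rpredD; first exact: gp.
  apply: rpredZ.
  by case: eqVneq => [->|_]; rewrite ?mulr1n ?rpred0.
(* The bound exceeds 1 even when p is constant, so that the index 1 occurs. *)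
suff /(dga_gr_indep gf)/(_ 1%N) : \sum_(i < (size p).+2) f i = 0.
  by rewrite /f mulr1n => /(_ isT)/eqP; rewrite subr_eq0 => /eqP.
have -> : \sum_(i < (size p).+2) f i =
          p.[1] - \sum_(i < (size p).+2) w *+ (i == 1 :> nat)%N.
  have le2 : (size p <= (size p).+2)%N by rewrite (leq_trans (leqnSn _)).
  rewrite (horner_coef_wide 1 le2) -sumrB.
  by apply: eq_bigr => i _; rewrite expr1n mulr1.
rewrite (bigD1 (lift ord0 ord0)) //= mulr1n big1 ?addr0 ?pw ?subrr // => i.
by rewrite -val_eqE /= => /negbTE ->.
Qed.

(** The subalgebra generated by A and dA is everything, so every form has a
    decomposition whose degree 1 component is in the span of the da b; for a
    form of degree 1 that component is the form itself. *)
Lemma form_span (w : O1) : exact_span w.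
Proof.
pose S : {pred dga_alg D} :=
  fun x => `[< exists2 p, spanned_poly p & p.[1] = x >].
have constS x : x \in dga_gr D 0 -> spanned_poly x%:P.
  move=> x0; split=> [i|]; first by rewrite coefC; case: i => //= i; exact: rpred0.
  by exists 0; [exact: exact_span0|rewrite coefC].
have inS a : dga_in D a \in dga_gr D 0 by apply/dga_gr0; exists a.
have SS : GRing.subalg_closed S.
  split=> [|c x y /asboolP[p sp <-] /asboolP[q sq <-]
          |x y /asboolP[p sp <-] /asboolP[q sq <-]].
  - apply/asboolP; exists 1%:P; last by rewrite hornerC.
    by apply: constS; apply/dga_gr0; exists 1; rewrite rmorph1.
  - apply/asboolP; exists ((c%:A)%:P * p + q).
      apply: spanned_polyD sq; apply: spanned_polyM sp.
      by apply: constS; apply/dga_gr0; exists c%:A; rewrite linearZ rmorph1.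
    by rewrite hornerD hornerCM mulr_algl.
  - apply/asboolP; exists (p * q); first exact: spanned_polyM.
    by rewrite hornerM_comm // /comm_poly mul1r mulr1.
have : val w \in S.
  apply: (dga_gen SS) => a; apply/asboolP.
    by exists (dga_in D a)%:P; [exact: constS|rewrite hornerC].
  exists (dga_d D (dga_in D a) *: 'X); last by rewrite hornerZ hornerX mulr1.
  split=> [i|].
    rewrite coefZ coefX; case: eqVneq => [->|_]; rewrite ?mulr0 ?rpred0 //.
    by rewrite mulr1; apply: dga_d_gr.
  by exists (d a); [exact: exact_span_d|rewrite coefZ coefX mulr1].
case/asboolP => p [gp [u su pu]] pw.
suff -> : w = u by [].
by apply: val_inj; rewrite -pu (form_coef1 gp _ pw) //; exact: subspace_mem.
Qed.

(** The principle behind all naturality statements on σ: the axioms of a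
    bimodule connection only control σ on tensors m ⊗ da, which determine a
    bimodule map. *)
Lemma form_ext (M N : bimodType A) (f g : (M ⊗ O1)%type -> N) :
  bimod_hom f -> bimod_hom g -> (forall m a, f (m ⊗ d a) = g (m ⊗ d a)) ->
  f =1 g.
Proof.
move=> hf hg fg; apply: hom_ext => // m w.
have [s ->] := form_span w; elim: s => [|[a b] s IH].
  by rewrite big_nil tens0r (bimod_hom0 hf) (bimod_hom0 hg).
rewrite big_cons tensDr (bimod_homD hf) (bimod_homD hg) IH; congr (_ + _).
by rewrite /= -ract_tens (bimod_map_r hf) (bimod_map_r hg) fg.
Qed.

End Span.

(** * Bimodules from products *)

Section Products.
Variables (k : fieldType) (A : algType k).

(** An algebra V is a bimodule over any algebra mapping to it.  The product of V
    is a bare operation [m], so no ring structure has to be declared on jets. *)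
Lemma bimodule_of_product (V : lmodType k) (m : V -> V -> V) (j : A -> V) :
  (forall x, linear (m x)) -> (forall y, linear (m^~ y)) -> associative m ->
  linear j -> {morph j : a b / a * b >-> m a b} ->
  left_id (j 1) m -> right_id (j 1) m ->
  is_bimodule (fun a => m (j a)) (fun v a => m v (j a)).
Proof.
move=> mr ml mA jl jM j1l j1r.
have mDr x y z : m x (y + z) = m x y + m x z.
  by have := mr x 1 y z; rewrite !scale1r.
have mDl x y z : m (x + y) z = m x z + m y z.
  by have := ml z 1 x y; rewrite !scale1r.
have jD a b : j (a + b) = j a + j b.
  by have := jl 1 a b; rewrite !scale1r.
have jZ c : j c%:A = c *: j 1.
  have j0 : j 0 = 0 by apply: (addIr (j 0)); rewrite -jD !add0r.
  by have := jl c 1 0; rewrite j0 !addr0.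
have mZr x c y : m x (c *: y) = c *: m x y.
  have m0 : m x 0 = 0 by apply: (addIr (m x 0)); rewrite -mDr !add0r.
  by have := mr x c y 0; rewrite m0 !addr0.
have mZl x c y : m (c *: x) y = c *: m x y.
  have m0 : m 0 y = 0 by apply: (addIr (m 0 y)); rewrite -mDl !add0r.
  by have := ml y c x 0; rewrite m0 !addr0.
split=> *; rewrite ?jM ?mA ?jD ?jZ ?mZl ?mZr ?mDl ?mDr ?j1l ?j1r //.
Qed.

Lemma bimodule_pullback (V W : lmodType k) (f : V -> W) l r L R :
  injective f -> linear f ->
  (forall a v, f (l a v) = L a (f v)) -> (forall v a, f (r v a) = R (f v) a) ->
  @is_bimodule k A W L R -> @is_bimodule k A V l r.
Proof.
move=> fI fl fL fR [h1 h2 h3 h4 h5 h6 h7 h8 h9 h10 h11].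
have fD x y : f (x + y) = f x + f y.
  by have := fl 1 x y; rewrite !scale1r.
have fZ c x : f (c *: x) = c *: f x.
  have f0 : f 0 = 0 by apply: (addIr (f 0)); rewrite -fD !add0r.
  by have := fl c x 0; rewrite f0 !addr0.
by split=> *; apply: fI; rewrite ?(fD, fZ, fL, fR).
Qed.
End Products.

(** * The braiding of a bimodule connection *)

Section Braiding.
Variables (k : fieldType) (A : algType k) (D : dga A).
Local Notation O1 := (Omega D 1).
Local Notation O2 := (Omega D 2).
Local Notation T2 := (O1 ⊗ O1)%type.
Local Notation T3 := (O1 ⊗ (O1 ⊗ O1))%type.
Local Notation d := (Omega_d0 D).
Variables (nabla : O1 -> T2) (sigma : T2 -> T2).
Hypothesis conn : bimod_connection nabla sigma.
Local Notation nabla2 := (nabla2 nabla sigma).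
Local Notation s1 := (sigma1 sigma).
Local Notation s2 := (sigma2 sigma).

Let sH : bimod_hom sigma := conn_sigma conn.
Let arH : bimod_hom (@assocr k A O1 O1 O1) := assocr_hom O1 O1 O1.

Lemma sigma1_hom : bimod_hom s1.
Proof. exact: on12_hom. Qed.
Lemma sigma2_hom : bimod_hom s2.
Proof. exact: on23_hom. Qed.
Let s1H := sigma1_hom.
Let s2H := sigma2_hom.

Lemma br2_hom : bimod_hom (br2 sigma).
Proof. exact: add_hom (bimod_hom_id _) sH. Qed.
Lemma br3_hom : bimod_hom (br3 sigma).
Proof.
exact: add_hom (add_hom (bimod_hom_id _) s2H) (bimod_hom_comp s1H s2H).
Qed.
Lemma br3'_hom : bimod_hom (br3' sigma).
Proof.
exact: add_hom (add_hom (bimod_hom_id _) s1H) (bimod_hom_comp s2H s1H).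
Qed.

Lemma sigma1_assocr t w : s1 (assocr (t ⊗ w)) = assocr (sigma t ⊗ w).
Proof. exact: on12_assocr. Qed.
Lemma sigma2_tens w t : s2 (w ⊗ t) = w ⊗ sigma t.
Proof. exact: on23_tens. Qed.

Lemma wedge12_assocr (t : T2) (w : O1) :
  wedge12 (assocr (t ⊗ w)) = wedge t ⊗ w.
Proof.
by rewrite /wedge12 assocrK tmap_tens //; exact: wedge_hom.
Qed.
Lemma wedge23_tens (w : O1) (t : T2) : wedge23 (w ⊗ t) = w ⊗ wedge t.
Proof.
by rewrite /wedge23 tmap_tens //; exact: wedge_hom.
Qed.

Lemma nablaD : {morph nabla : x y / x + y}.
Proof. by move=> x y; have := conn_linear conn 1 x y; rewrite !scale1r. Qed.
Lemma nabla0 : nabla 0 = 0.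
Proof. by apply: (addIr (nabla 0)); rewrite -nablaD !add0r. Qed.
Lemma nablaZ c x : nabla (c *: x) = c *: nabla x.
Proof. by have := conn_linear conn c x 0; rewrite nabla0 !addr0. Qed.

Lemma nabla2D : {morph nabla2 : x y / x + y}.
Proof.
have nE t : nabla2 t = tlift (fun w h => nabla2 (w ⊗ h)) t.
  by apply: eq_tlift => w h; rewrite (nabla2_tens conn).
move=> x y; rewrite !nE tliftD //.
split=> [w1 w2 e|e e1 e2|e|e a f]; rewrite ?tensA // !(nabla2_tens conn).
- by rewrite nablaD !tensDl (bimod_homD arH) (bimod_homD s1H) addrACA.
- by rewrite nablaD !tensDr (bimod_homD arH) (bimod_homD s1H) addrACA.
- by rewrite nabla0 !tens0l (bimod_hom0 arH) (bimod_hom0 s1H) addr0.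
Qed.
Lemma nabla20 : nabla2 0 = 0.
Proof. by apply: (addIr (nabla2 0)); rewrite -nabla2D !add0r. Qed.

(** With the next lemma: ∇_2 is a left connection on Ω^1 ⊗ Ω^1 which satisfies
    the right Leibniz rule with generalised braiding σ_1 σ_2. *)
Lemma nabla2_lact a t : nabla2 (a ▷ t) = d a ⊗ t + a ▷ nabla2 t.
Proof.
elim/tens_ind: t => [|x y IHx IHy|w h].
- by rewrite lact0 nabla20 tens0r lact0 addr0.
- by rewrite lactDr !nabla2D IHx IHy tensDr lactDr addrACA.
- rewrite lact_tens !(nabla2_tens conn) (conn_left conn) tensDl.
  rewrite (bimod_homD arH) assocr_tens -addrA; congr (_ + _).
  by rewrite lactDr -(bimod_map_l arH) -(bimod_map_l s1H) !lact_tens.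
Qed.

Lemma nabla2_ract t a :
  nabla2 (t ◁ a) = nabla2 t ◁ a + s1 (s2 (assocr (t ⊗ d a))).
Proof.
elim/tens_ind: t => [|x y IHx IHy|w h].
- rewrite ract0 nabla20 tens0l (bimod_hom0 arH) (bimod_hom0 s2H).
  by rewrite (bimod_hom0 s1H) ract0 addr0.
- rewrite ractDl !nabla2D IHx IHy tensDl (bimod_homD arH) (bimod_homD s2H).
  by rewrite (bimod_homD s1H) ractDl addrACA.
- rewrite ract_tens !(nabla2_tens conn) (conn_right conn) tensDr.
  rewrite (bimod_homD s1H) assocr_tens sigma2_tens addrA; congr (_ + _).
  by rewrite ractDl -(bimod_map_r arH) -(bimod_map_r s1H) !ract_tens.
Qed.

Lemma nabla2Z c t : nabla2 (c *: t) = c *: nabla2 t.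
Proof. by rewrite -!lactA nabla2_lact d0Z d0_1 scaler0 tens0l add0r. Qed.

Lemma nabla_dM a b :
  nabla (d (a * b)) = a ▷ nabla (d b) + br2 sigma (d a ⊗ d b) + nabla (d a) ◁ b.
Proof.
rewrite d0M nablaD (conn_right conn) (conn_left conn) /br2.
by rewrite [LHS](AC (2*2) (4*(3*2)*1)).
Qed.

(** Leibniz compatibility on t a differs from Leibniz compatibility on t acted on
    by a exactly by the braid relation on t ⊗ da. *)
Lemma braid : leibniz_compatible nabla sigma ->
  forall u, s1 (s2 (s1 u)) = s2 (s1 (s2 u)).
Proof.
move=> leib u; rewrite -(assoclK u); move: (assocl u).
apply: form_ext => [||t a].
- exact: bimod_hom_comp s1H (bimod_hom_comp s2H (bimod_hom_comp s1H arH)).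
- exact: bimod_hom_comp s2H (bimod_hom_comp s1H (bimod_hom_comp s2H arH)).
have := leib (t ◁ a).
rewrite (bimod_map_r sH) !nabla2_ract leib (bimod_homD s2H) (bimod_map_r s2H).
by move/addrI; rewrite -sigma1_assocr.
Qed.

(** Both sides are the sum of the six permutation braids on three strands; the
    longest one is written σ_1σ_2σ_1 on the left and σ_2σ_1σ_2 on the right. *)
Lemma br3_shuffle : leibniz_compatible nabla sigma ->
  forall u, br3 sigma (u + s1 u) = br3' sigma (u + s2 u).
Proof.
move=> leib u; rewrite /br3 /br3' !(bimod_homD s1H, bimod_homD s2H).
by rewrite (braid leib) !addrA [LHS](ACl (1*3*2*5*4*6)).
Qed.

(** The degree 3 component of the multiplicativity of the jet prolongation. *)
Lemma nabla2_nabla_dM : leibniz_compatible nabla sigma -> forall a b,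
  nabla2 (nabla (d (a * b))) =
    a ▷ nabla2 (nabla (d b)) + br3' sigma (d a ⊗ nabla (d b))
    + br3 sigma (assocr (nabla (d a) ⊗ d b)) + nabla2 (nabla (d a)) ◁ b.
Proof.
move=> leib a b; rewrite nabla_dM !nabla2D nabla2_lact nabla2_ract leib.
rewrite (nabla2_tens conn) (bimod_homD s2H) /br3 /br3' !addrA.
by rewrite [LHS](ACl (2*1*4*6*3*5*8*7)).
Qed.

(** The degree (1,1,1) component of associativity of the jet product. *)
Lemma br2_assoc : leibniz_compatible nabla sigma -> forall w h z : O1,
  br3' sigma (w ⊗ br2 sigma (h ⊗ z)) =
    br3 sigma (assocr (br2 sigma (w ⊗ h) ⊗ z)).
Proof.
move=> leib w h z; rewrite /br2 tensDr tensDl (bimod_homD arH).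
by rewrite -sigma2_tens -sigma1_assocr assocr_tens br3_shuffle.
Qed.

(** Comparing d(ωa) = (dω)a - ω ∧ da with ∧∇(ωa) gives ∧σ = -∧ on ω ⊗ da. *)
Lemma wedge_br2 : torsion_free nabla -> forall t, wedge (br2 sigma t) = 0.
Proof.
move=> tf; have wH := wedge_hom D; apply: form_ext => [||w a].
- exact: bimod_hom_comp wH br2_hom.
- exact: zero_hom.
have : wedge (nabla (w ◁ a)) = wedge (nabla w) ◁ a - wedge11 w (d a).
  rewrite !tf; apply: val_inj; rewrite /= (dga_leibniz _ (subspace_mem w)).
  by rewrite expr1 mulN1r.
rewrite (conn_right conn) (bimod_homD wH) (bimod_map_r wH) => /addrI e.
by rewrite /br2 (bimod_homD wH) e wedge_tens subrr.
Qed.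

Lemma wedge12_br2 : torsion_free nabla -> forall u, wedge12 (u + s1 u) = 0.
Proof.
move=> tf u; have wH := wedge12_hom D O1.
rewrite -(assoclK u); move: (assocl u).
apply: hom_ext => [||t w]; last 1 first.
- by rewrite sigma1_assocr -(bimod_homD arH) -tensDl wedge12_assocr wedge_br2
    ?tens0l.
- apply: bimod_hom_comp wH _.
  exact: add_hom arH (bimod_hom_comp s1H arH).
- exact: zero_hom.
Qed.

Lemma wedge23_br2 : torsion_free nabla -> forall u, wedge23 (u + s2 u) = 0.
Proof.
move=> tf; have wH := wedge23_hom D.
apply: hom_ext => [||w t].
- exact: bimod_hom_comp wH (add_hom (bimod_hom_id _) s2H).
- exact: zero_hom.
- by rewrite sigma2_tens -tensDr wedge23_tens wedge_br2 ?tens0r.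
Qed.

(** Since ∧_1 σ_1 = -∧_1, the term σ_1(id ⊗ ∇) of ∇_2 contributes the minus sign
    of the curvature operator.  The two operators are sums over the same
    representative of [t] and can be compared termwise. *)
Lemma wedge12_nabla2 : torsion_free nabla ->
  forall t, wedge12 (nabla2 t) = d_id_nabla nabla t.
Proof.
move=> tf t; have wH := wedge12_hom D O1.
rewrite /Defs.nabla2 /d_id_nabla /tlift.
rewrite (big_morph _ (bimod_homD wH) (bimod_hom0 wH)).
apply: eq_bigr => p _; rewrite (bimod_homD wH) wedge12_assocr tf.
congr (_ + _); apply/eqP; rewrite -addr_eq0 addrC -(bimod_homD wH).
by rewrite wedge12_br2.
Qed.

Lemma wedge23_nabla2 nablaO2 sigmaO2 :
  bimod_connection nablaO2 sigmaO2 ->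
  (forall h w : O1, nablaO2 (wedge (h ⊗ w)) =
      wedge23 (assocr (nabla h ⊗ w)) + wedge23 (s1 (h ⊗ nabla w))) ->
  forall t, wedge23 (nabla2 t) = nablaO2 (wedge t).
Proof.
move=> c2 nE; have w1H := wedge_hom D; have w2H := wedge23_hom D.
have nD x y : nablaO2 (x + y) = nablaO2 x + nablaO2 y.
  by have := conn_linear c2 1 x y; rewrite !scale1r.
have n0 : nablaO2 0 = 0 by apply: (addIr (nablaO2 0)); rewrite -nD !add0r.
elim/tens_ind => [|x y IHx IHy|w h].
- by rewrite nabla20 (bimod_hom0 w1H) (bimod_hom0 w2H) n0.
- by rewrite nabla2D (bimod_homD w1H) (bimod_homD w2H) nD IHx IHy.
- by rewrite nE (nabla2_tens conn) (bimod_homD w2H).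
Qed.

(** The right Leibniz rules of ∇_2 and of the connection on Ω^2, which ∧
    intertwines, show that ∧_2 σ_1 σ_2 factors through ∧_1, by way of the
    generalised braiding of Ω^2. *)
Lemma wedge23_sigma12 : wedge_compatible nabla sigma ->
  forall t w, wedge t = 0 -> wedge23 (s1 (s2 (assocr (t ⊗ w)))) = 0.
Proof.
move=> [nO [sO [c2 nE]]] t w t0.
have w1H := wedge_hom D; have w2H := wedge23_hom D.
have H := wedge23_nabla2 c2 nE.
suff /(_ (t ⊗ w)) : (fun v => wedge23 (s1 (s2 (assocr v)))) =1
    sO \o tmap (@wedge k A D) id.
  move=> /= ->; rewrite tmap_tens //.
  by rewrite t0 tens0l (bimod_hom0 (conn_sigma c2)).
apply: form_ext => [||{w t0}t a] /=.
- exact: bimod_hom_comp w2H (bimod_hom_comp s1H (bimod_hom_comp s2H arH)).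
- apply: bimod_hom_comp (conn_sigma c2) _.
  by apply: tmap_hom w1H _; exact: bimod_hom_id.
rewrite tmap_tens //.
have := H (t ◁ a); rewrite nabla2_ract (bimod_homD w2H) (bimod_map_r w2H).
by rewrite (bimod_map_r w1H) (conn_right c2) H => /addrI.
Qed.

(** Extendability says that ∧_1 σ_2 σ_1 factors through ∧_2. *)
Lemma wedge12_sigma21 : extendable sigma ->
  forall w t, wedge t = 0 -> wedge12 (s2 (s1 (w ⊗ t))) = 0.
Proof.
move=> [tau [tH tE]] w t t0.
have w1H := wedge_hom D; have w2H := wedge12_hom D O1.
suff /(_ (w ⊗ t)) : (fun v => wedge12 (s2 (s1 v))) =1 tau \o @wedge23 k A D.
  by move=> /= ->; rewrite wedge23_tens t0 tens0r (bimod_hom0 tH).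
have fH : bimod_hom (fun v => wedge12 (s2 (s1 v))).
  exact: bimod_hom_comp w2H (bimod_hom_comp s2H s1H).
have gH : bimod_hom (tau \o @wedge23 k A D).
  exact: bimod_hom_comp tH (wedge23_hom D).
apply: hom_ext => //= {t0 w t}w t; rewrite wedge23_tens.
elim/tens_ind: t => [|x y IHx IHy|h z]; last by rewrite tE.
- by rewrite (bimod_hom0 w1H) !tens0r (bimod_hom0 fH) (bimod_hom0 tH).
- by rewrite (bimod_homD w1H) !tensDr (bimod_homD fH) (bimod_homD tH) IHx IHy.
Qed.

(** Grouping [3,σ] as id + (id + σ_1)σ_2 for ∧_1, and as (id + σ_2) + σ_1σ_2 for
    ∧_2, leaves ∧_1 and ∧_2 σ_1 σ_2, which both vanish on Ω^2_S ⊗ Ω^1. *)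
Lemma br3_sym : torsion_free nabla -> wedge_compatible nabla sigma ->
  forall t w, t \in @sym2 k A D -> br3 sigma (assocr (t ⊗ w)) \in @sym3 k A D.
Proof.
move=> tf wc t w /eqP t0; rewrite sym3E; apply/andP; split; apply/eqP.
  rewrite /br3 -addrA (bimod_homD (wedge12_hom D O1)) wedge12_br2 // addr0.
  by rewrite wedge12_assocr t0 tens0l.
rewrite (bimod_homD (wedge23_hom D)) wedge23_br2 // add0r.
exact: wedge23_sigma12.
Qed.

(** The mirror image of [br3_sym]: [3,σ]' is (id + σ_1) + σ_2σ_1 for ∧_1, and
    id + (id + σ_2)σ_1 for ∧_2. *)
Lemma br3'_sym : torsion_free nabla -> extendable sigma ->
  forall w t, t \in @sym2 k A D -> br3' sigma (w ⊗ t) \in @sym3 k A D.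
Proof.
move=> tf ext w t /eqP t0; rewrite sym3E; apply/andP; split; apply/eqP.
  rewrite (bimod_homD (wedge12_hom D O1)) wedge12_br2 // add0r.
  exact: wedge12_sigma21.
rewrite /br3' -addrA (bimod_homD (wedge23_hom D)) wedge23_br2 // addr0.
by rewrite wedge23_tens t0 tens0r.
Qed.

Lemma nabla_d_sym : torsion_free nabla -> forall a, nabla (d a) \in @sym2 k A D.
Proof. by move=> tf a; rewrite sym2E tf; apply/eqP/val_inj/dga_dd. Qed.

(** ∧_1 of ∇_2∇da is the curvature of ∇ on da, and ∧_2 of it is
    ∇_{Ω^2}(∧∇da) = ∇_{Ω^2}(dda). *)
Lemma nabla2_nabla_d_sym : torsion_free nabla -> flat nabla ->
  wedge_compatible nabla sigma ->
  forall a, nabla2 (nabla (d a)) \in @sym3 k A D.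
Proof.
move=> tf fl [nO [sO [c2 nE]]] a; rewrite sym3E wedge12_nabla2 // fl eqxx /=.
rewrite (wedge23_nabla2 c2 nE) (eqP (nabla_d_sym tf a)).
by rewrite -(lact0l 0) (conn_left c2) lact0l addr0 -(scale0r 1) d0Z scale0r
  tens0l.
Qed.

End Braiding.

(** * Jets as a subspace of the tensors of degree at most 3 *)

Section Ambient.
Variables (k : fieldType) (A : algType k) (D : dga A).

HB.instance Definition _ := GRing.Lmodule.on (Amb2 D).
HB.instance Definition _ := GRing.Lmodule.on (Amb3 D).

Lemma jet2_amb_linear : linear (@jet2_amb k A D).
Proof. by []. Qed.
Lemma jet3_amb_linear : linear (@jet3_amb k A D).
Proof. by []. Qed.

Lemma jet2_amb_inj : injective (@jet2_amb k A D).
Proof. by move=> [[s w] t] [[s' w'] t'] [-> -> /val_inj ->]. Qed.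
Lemma jet3_amb_inj : injective (@jet3_amb k A D).
Proof.
move=> [x u] [x' u'] [] *; congr (_, _); last exact: val_inj.
by apply: jet2_amb_inj; congr (_, _, _).
Qed.

Definition in_jet2 (x : Amb2 D) : Prop := x.2 \in @sym2 k A D.
Definition in_jet3 (x : Amb3 D) : Prop := in_jet2 x.1 /\ x.2 \in @sym3 k A D.

Lemma jet2_amb_in (x : Jet2 D) : in_jet2 (jet2_amb x).
Proof. exact: subspace_mem. Qed.
Lemma jet3_amb_in (x : Jet3 D) : in_jet3 (jet3_amb x).
Proof. by split; exact: subspace_mem. Qed.

Definition to_jet2 (x : Amb2 D) (hx : in_jet2 x) : Jet2 D :=
  (x.1, Subspace hx).
Definition to_jet3 (x : Amb3 D) (hx : in_jet3 x) : Jet3 D :=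
  (to_jet2 hx.1, Subspace hx.2).

Lemma to_jet2K x (hx : in_jet2 x) : jet2_amb (to_jet2 hx) = x.
Proof. by move: x hx => [[s w] t]. Qed.
Lemma to_jet3K x (hx : in_jet3 x) : jet3_amb (to_jet3 hx) = x.
Proof. by move: x hx => [[[s w] t] u]. Qed.

End Ambient.

(** * The truncated graded product *)

Section Scaling.
Variables (k : fieldType) (A : algType k) (M N : bimodType A).

Lemma lactZl c a (v : M) : (c *: a) ▷ v = c *: (a ▷ v).
Proof. by rewrite -mulr_algl lactM lactA. Qed.
Lemma ractZr c a (v : M) : v ◁ (c *: a) = c *: (v ◁ a).
Proof. by rewrite -mulr_algr ractM ractA. Qed.
Lemma bimod_homZ (f : M -> N) c v : bimod_hom f -> f (c *: v) = c *: f v.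
Proof. by move=> fH; rewrite -!lactA (bimod_map_l fH). Qed.
End Scaling.

(** The components are arbitrary bimodule maps tied by [b_assoc], the one
    non-formal instance of associativity.  Keeping them abstract also prevents
    rewriting from seeing the sums inside [br2] and [br3]. *)
Section GradedProduct.
Variables (k : fieldType) (A : algType k) (D : dga A).
Local Notation O1 := (Omega D 1).
Local Notation T2 := (O1 ⊗ O1)%type.
Local Notation T3 := (O1 ⊗ (O1 ⊗ O1))%type.
Variables (b : T2 -> T2) (b12 b21 : T3 -> T3).
Hypotheses (bH : bimod_hom b) (b12H : bimod_hom b12) (b21H : bimod_hom b21).
Hypothesis b_assoc : forall w h z : O1,
  b12 (w ⊗ b (h ⊗ z)) = b21 (assocr (b (w ⊗ h) ⊗ z)).

Let arH : bimod_hom (@assocr k A O1 O1 O1) := assocr_hom O1 O1 O1.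

Definition mul2 (x y : Amb2 D) : Amb2 D :=
  let: (s, w, t) := x in
  let: (s', w', t') := y in
  (s * s', s ▷ w' + w ◁ s', s ▷ t' + b (w ⊗ w') + t ◁ s').

Definition mul3 (x y : Amb3 D) : Amb3 D :=
  let: (s, w, t, u) := x in
  let: (s', w', t', u') := y in
  (mul2 (s, w, t) (s', w', t'),
   s ▷ u' + b12 (w ⊗ t') + b21 (assocr (t ⊗ w')) + u ◁ s').

Lemma mul2A : associative mul2.
Proof.
move=> [[s w] t] [[s' w'] t'] [[s'' w''] t'']; congr (_, _, _).
- exact: mulrA.
- by rewrite lactDr ractDl lactM ractM lractA addrA.
- rewrite !(lactDr, ractDl, tensDl, tensDr, bimod_homD bH) lactM ractM lractA.
  rewrite -(bimod_map_l bH) -(bimod_map_r bH) lact_tens ract_tens tensA.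
  by rewrite !addrA [LHS](ACl (1*2*4*3*5*6)).
Qed.

Lemma mul3A : associative mul3.
Proof.
move=> [[[s w] t] u] [[[s' w'] t'] u'] [[[s'' w''] t''] u''].
congr (_, _); first exact: (mul2A (s, w, t) (s', w', t') (s'', w'', t'')).
rewrite !(lactDr, ractDl, tensDl, tensDr, bimod_homD b21H, bimod_homD b12H,
          bimod_homD arH).
rewrite -!(bimod_map_l b21H, bimod_map_r b21H, bimod_map_l b12H,
           bimod_map_r b12H, bimod_map_l arH, bimod_map_r arH).
rewrite b_assoc !(lact_tens, ract_tens, tensA) lactM ractM lractA.
by rewrite !addrA [LHS](ACl (1*2*5*3*6*8*4*7*9*10)).
Qed.

Lemma mul2_linearr x : linear (mul2 x).
Proof.
move: x => [[s w] t] c [[s1 w1] t1] [[s2 w2] t2]; congr (_, _, _) => /=.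
- by rewrite mulrDr -scalerAr.
- by rewrite lactDr ractDr lactZ ractZr scalerDr addrACA.
- rewrite lactDr ractDr tensDr (bimod_homD bH) lactZ ractZr tensZr.
  rewrite (bimod_homZ _ _ bH) !scalerDr.
  by rewrite [LHS](AC (2*2*2) ((1*3*5)*(2*4*6))).
Qed.

Lemma mul2_linearl y : linear (mul2^~ y).
Proof.
move: y => [[s w] t] c [[s1 w1] t1] [[s2 w2] t2]; congr (_, _, _) => /=.
- by rewrite mulrDl -scalerAl.
- by rewrite lactDl ractDl lactZl ractZ scalerDr addrACA.
- rewrite lactDl ractDl tensDl (bimod_homD bH) lactZl ractZ tensZl.
  rewrite (bimod_homZ _ _ bH) !scalerDr.
  by rewrite [LHS](AC (2*2*2) ((1*3*5)*(2*4*6))).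
Qed.

Lemma mul3_linearr x : linear (mul3 x).
Proof.
move: x => [[[s w] t] u] c [[[s1 w1] t1] u1] [[[s2 w2] t2] u2].
congr (_, _).
  exact: (mul2_linearr (s, w, t) c (s1, w1, t1) (s2, w2, t2)).
move=> /=; rewrite lactDr ractDr !tensDr !(bimod_homD b12H, bimod_homD arH).
rewrite (bimod_homD b21H) lactZ ractZr !tensZr.
rewrite !(bimod_homZ _ _ b12H, bimod_homZ _ _ arH) (bimod_homZ _ _ b21H) !scalerDr.
by rewrite [LHS](AC (2*2*2*2) ((1*3*5*7)*(2*4*6*8))).
Qed.

Lemma mul3_linearl y : linear (mul3^~ y).
Proof.
move: y => [[[s w] t] u] c [[[s1 w1] t1] u1] [[[s2 w2] t2] u2].
congr (_, _).
  exact: (mul2_linearl (s, w, t) c (s1, w1, t1) (s2, w2, t2)).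
move=> /=; rewrite lactDl ractDl !tensDl !(bimod_homD b12H, bimod_homD arH).
rewrite (bimod_homD b21H) lactZl ractZ !tensZl.
rewrite !(bimod_homZ _ _ b12H, bimod_homZ _ _ arH) (bimod_homZ _ _ b21H) !scalerDr.
by rewrite [LHS](AC (2*2*2*2) ((1*3*5*7)*(2*4*6*8))).
Qed.

Definition one2 : Amb2 D := (1, 0, 0).
Definition one3 : Amb3 D := (one2, 0).

Lemma mul2_1l : left_id one2 mul2.
Proof.
move=> [[s w] t]; congr (_, _, _).
- exact: mul1r.
- by rewrite lact1 ract0 addr0.
- by rewrite lact1 ract0 tens0l (bimod_hom0 bH) !addr0.
Qed.
Lemma mul2_1r : right_id one2 mul2.
Proof.
move=> [[s w] t]; congr (_, _, _).
- exact: mulr1.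
- by rewrite ract1 lact0 add0r.
- by rewrite ract1 lact0 tens0r (bimod_hom0 bH) !add0r.
Qed.
Lemma mul3_1l : left_id one3 mul3.
Proof.
move=> [[[s w] t] u]; congr (_, _); first exact: (mul2_1l (s, w, t)).
rewrite lact1 ract0 !tens0l (bimod_hom0 b12H) (bimod_hom0 arH).
by rewrite (bimod_hom0 b21H) !addr0.
Qed.
Lemma mul3_1r : right_id one3 mul3.
Proof.
move=> [[[s w] t] u]; congr (_, _); first exact: (mul2_1r (s, w, t)).
rewrite ract1 lact0 !tens0r (bimod_hom0 b12H) (bimod_hom0 arH).
by rewrite (bimod_hom0 b21H) !add0r.
Qed.

End GradedProduct.

(** * The jet prolongation is an algebra map *)

Section JetMaps.
Variables (k : fieldType) (A : algType k) (D : dga A).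
Local Notation O1 := (Omega D 1).
Local Notation T2 := (O1 ⊗ O1)%type.
Local Notation T3 := (O1 ⊗ (O1 ⊗ O1))%type.
Variables (nabla : O1 -> T2) (sigma : T2 -> T2).
Hypothesis conn : bimod_connection nabla sigma.

Local Notation m2 := (mul2 (br2 sigma)).
Local Notation m3 := (mul3 (br2 sigma) (br3' sigma) (br3 sigma)).
Local Notation j2 := (j2_amb nabla).
Local Notation j3 := (j3_amb nabla sigma).

Lemma lact2E a x : lact2 nabla sigma a x = m2 (j2 a) x.
Proof.
move: x => [[s w] t]; congr (_, _, _); first exact: addrC.
by rewrite [LHS](ACl (3*2*1)).
Qed.
Lemma ract2E x a : ract2 nabla sigma x a = m2 x (j2 a).
Proof. by move: x => [[s w] t]. Qed.
Lemma lact3E a x : lact3 nabla sigma a x = m3 (j3 a) x.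
Proof.
move: x => [[[s w] t] u]; congr (_, _); first exact: (lact2E a (s, w, t)).
by rewrite [LHS](ACl (4*3*2*1)).
Qed.
Lemma ract3E x a : ract3 nabla sigma x a = m3 x (j3 a).
Proof. by move: x => [[[s w] t] u]. Qed.

Lemma j2_amb_linear : linear j2.
Proof.
by move=> c a b; congr (_, _, _);
  rewrite d0D d0Z ?(nablaD conn) ?(nablaZ conn).
Qed.
Lemma j3_amb_linear : linear j3.
Proof.
move=> c a b; congr (_, _); first exact: j2_amb_linear.
by rewrite d0D d0Z (nablaD conn) (nablaZ conn) (nabla2D conn) (nabla2Z conn).
Qed.

Lemma j2_ambM : {morph j2 : a b / a * b >-> m2 a b}.
Proof.
move=> a b; congr (_, _, _); first by rewrite d0M addrC.
exact: nabla_dM.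
Qed.
Lemma j3_ambM : leibniz_compatible nabla sigma ->
  {morph j3 : a b / a * b >-> m3 a b}.
Proof.
move=> leib a b; congr (_, _); first exact: j2_ambM.
exact: nabla2_nabla_dM.
Qed.
Lemma j2_amb1 : j2 1 = one2 D.
Proof. by congr (_, _, _); rewrite d0_1 ?(nabla0 conn). Qed.
Lemma j3_amb1 : j3 1 = one3 D.
Proof.
congr (_, _); first exact: j2_amb1.
by rewrite d0_1 (nabla0 conn) (nabla20 conn).
Qed.

Lemma in_jet2_mul : torsion_free nabla ->
  forall x y, in_jet2 x -> in_jet2 y -> in_jet2 (m2 x y).
Proof.
move=> tf [[s w] t] [[s' w'] t']; rewrite /in_jet2 !sym2E /= => /eqP t0 /eqP t'0.
have wH := wedge_hom D.
rewrite 2!(bimod_homD wH) (bimod_map_l wH) (bimod_map_r wH) t0 t'0 lact0 ract0.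
by rewrite (wedge_br2 conn tf) !addr0.
Qed.

Lemma in_jet3_mul : torsion_free nabla -> wedge_compatible nabla sigma ->
  extendable sigma ->
  forall x y, in_jet3 x -> in_jet3 y -> in_jet3 (m3 x y).
Proof.
move=> tf wc ext [[[s w] t] u] [[[s' w'] t'] u'] [ht hu] [ht' hu'].
split; first exact: (in_jet2_mul tf ht ht').
have s3l a v : v \in @sym3 k A D -> a ▷ v \in @sym3 k A D.
  rewrite !sym3E (bimod_map_l (wedge12_hom D O1)) (bimod_map_l (wedge23_hom D)).
  by move=> /andP[/eqP-> /eqP->]; rewrite !lact0 !eqxx.
have s3r a v : v \in @sym3 k A D -> v ◁ a \in @sym3 k A D.
  rewrite !sym3E (bimod_map_r (wedge12_hom D O1)) (bimod_map_r (wedge23_hom D)).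
  by move=> /andP[/eqP-> /eqP->]; rewrite !ract0 !eqxx.
apply: rpredD (s3r _ _ hu); apply: rpredD; first apply: rpredD (s3l _ _ hu') _.
  exact: (br3'_sym conn tf ext _ ht').
exact: (br3_sym conn tf wc _ ht).
Qed.

Lemma j2_in : torsion_free nabla -> forall a, in_jet2 (j2 a).
Proof. by move=> tf a; exact: nabla_d_sym. Qed.
Lemma j3_in : torsion_free nabla -> flat nabla ->
  wedge_compatible nabla sigma -> forall a, in_jet3 (j3 a).
Proof. by move=> tf fl wc a; split; [exact: j2_in|exact: nabla2_nabla_d_sym]. Qed.

(** The bimodule laws hold on all tensors, symmetric or not; jets inherit them
    through the injection into the ambient space. *)
Lemma amb2_bimodule : leibniz_compatible nabla sigma ->
  is_bimodule (lact2 nabla sigma) (ract2 nabla sigma).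
Proof.
move=> leib; rewrite (funext (fun a => funext (lact2E a))).
rewrite (funext (fun x => funext (ract2E x))).
have bH := br2_hom conn.
apply: bimodule_of_product; rewrite ?j2_amb1.
- exact: mul2_linearr.
- exact: mul2_linearl.
- exact: mul2A.
- exact: j2_amb_linear.
- exact: j2_ambM.
- exact: mul2_1l.
- exact: mul2_1r.
Qed.

Lemma amb3_bimodule : leibniz_compatible nabla sigma ->
  is_bimodule (lact3 nabla sigma) (ract3 nabla sigma).
Proof.
move=> leib; rewrite (funext (fun a => funext (lact3E a))).
rewrite (funext (fun x => funext (ract3E x))).
have bH := br2_hom conn; have pH := br3'_hom conn; have qH := br3_hom conn.
apply: bimodule_of_product; rewrite ?j3_amb1.
- exact: mul3_linearr.
- exact: mul3_linearl.
- by apply: mul3A => //; exact: (br2_assoc conn leib).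
- exact: j3_amb_linear.
- exact: j3_ambM.
- exact: mul3_1l.
- exact: mul3_1r.
Qed.

End JetMaps.

Theorem theorem3p6 (k : fieldType) (A : algType k) (D : dga A)
    (nabla : Omega D 1 -> (Omega D 1 ⊗ Omega D 1)%type)
    (sigma : (Omega D 1 ⊗ Omega D 1)%type -> (Omega D 1 ⊗ Omega D 1)%type) :
  bimod_connection nabla sigma ->
  torsion_free nabla ->
  flat nabla ->
  wedge_compatible nabla sigma ->
  extendable sigma ->
  leibniz_compatible nabla sigma ->
  exists (l2 : A -> Jet2 D -> Jet2 D) (r2 : Jet2 D -> A -> Jet2 D)
         (l3 : A -> Jet3 D -> Jet3 D) (r3 : Jet3 D -> A -> Jet3 D)
         (j2 : A -> Jet2 D) (j3 : A -> Jet3 D),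
    (forall a x, jet2_amb (l2 a x) = lact2 nabla sigma a (jet2_amb x)) /\
    (forall x a, jet2_amb (r2 x a) = ract2 nabla sigma (jet2_amb x) a) /\
    (forall a x, jet3_amb (l3 a x) = lact3 nabla sigma a (jet3_amb x)) /\
    (forall x a, jet3_amb (r3 x a) = ract3 nabla sigma (jet3_amb x) a) /\
    (forall s, jet2_amb (j2 s) = j2_amb nabla s) /\
    (forall s, jet3_amb (j3 s) = j3_amb nabla sigma s) /\
    is_bimodule l2 r2 /\
    is_bimodule l3 r3 /\
    is_bimod_map *%R *%R l3 r3 j3 /\
    is_bimod_map l3 r3 l2 r2 (@pi3 k A D) /\
    (forall y : Jet2 D, exists x : Jet3 D, pi3 x = y) /\
    (forall s, pi3 (j3 s) = j2 s).
Proof.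
move=> conn tf fl wc ext leib.
have jin2 a := j2_in tf a; have jin3 a := j3_in conn tf fl wc a.
have mul2_in := in_jet2_mul conn tf; have mul3_in := in_jet3_mul conn tf wc ext.
have lin2 a x : in_jet2 (lact2 nabla sigma a (jet2_amb x)).
  by rewrite lact2E; apply: mul2_in (jin2 a) _; exact: jet2_amb_in.
have rin2 x a : in_jet2 (ract2 nabla sigma (jet2_amb x) a).
  by rewrite ract2E; apply: mul2_in (jin2 a); exact: jet2_amb_in.
have lin3 a x : in_jet3 (lact3 nabla sigma a (jet3_amb x)).
  by rewrite lact3E; apply: mul3_in (jin3 a) _; exact: jet3_amb_in.
have rin3 x a : in_jet3 (ract3 nabla sigma (jet3_amb x) a).
  by rewrite ract3E; apply: mul3_in (jin3 a); exact: jet3_amb_in.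
pose l2 a x := to_jet2 (lin2 a x); pose r2 x a := to_jet2 (rin2 x a).
pose l3 a x := to_jet3 (lin3 a x); pose r3 x a := to_jet3 (rin3 x a).
pose j2 a := to_jet2 (jin2 a); pose j3 a := to_jet3 (jin3 a).
have l2E a x : jet2_amb (l2 a x) = lact2 nabla sigma a (jet2_amb x).
  exact: to_jet2K.
have r2E x a : jet2_amb (r2 x a) = ract2 nabla sigma (jet2_amb x) a.
  exact: to_jet2K.
have l3E a x : jet3_amb (l3 a x) = lact3 nabla sigma a (jet3_amb x).
  exact: to_jet3K.
have r3E x a : jet3_amb (r3 x a) = ract3 nabla sigma (jet3_amb x) a.
  exact: to_jet3K.
have j2E a : jet2_amb (j2 a) = j2_amb nabla a by exact: to_jet2K.
have j3E a : jet3_amb (j3 a) = j3_amb nabla sigma a by exact: to_jet3K.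
have pi3E x : jet2_amb (pi3 x) = (jet3_amb x).1 by [].
have amb3_fstl a y : (lact3 nabla sigma a y).1 = lact2 nabla sigma a y.1.
  by move: y => [[[s w] t] u].
have amb3_fstr y a : (ract3 nabla sigma y a).1 = ract2 nabla sigma y.1 a.
  by move: y => [[[s w] t] u].
have bim2 : is_bimodule l2 r2.
  apply: bimodule_pullback l2E r2E (amb2_bimodule conn leib).
    exact: jet2_amb_inj.
  exact: jet2_amb_linear.
have bim3 : is_bimodule l3 r3.
  apply: bimodule_pullback l3E r3E (amb3_bimodule conn leib).
    exact: jet3_amb_inj.
  exact: jet3_amb_linear.
exists l2, r2, l3, r3, j2, j3; do 8!split=> //; split; first split.
- move=> c a b; apply: jet3_amb_inj.
  by rewrite jet3_amb_linear !j3E (j3_amb_linear conn).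
- by move=> a b; apply: jet3_amb_inj; rewrite l3E !j3E (j3_ambM conn leib) lact3E.
- by move=> a b; apply: jet3_amb_inj; rewrite r3E !j3E (j3_ambM conn leib) ract3E.
split; first split.
- by [].
- by move=> a x; apply: jet2_amb_inj; rewrite l2E !pi3E l3E amb3_fstl.
- by move=> x a; apply: jet2_amb_inj; rewrite r2E !pi3E r3E amb3_fstr.
split=> [y|a]; first by exists (y, 0).
by apply: jet2_amb_inj; rewrite pi3E j3E j2E.
Qed.
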